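(* Let $p\ge 2$, let $m\ge 1$, $n\ge 1$ be integers, and set $d=m+n$. There is a constant $c>0$, depending only on $p,m,n$, such that for all real $T\ge1$ and all $N\in 2^{\mathbb N}$ there exist nonzero $\phi_1,\phi_2,\phi_3\in L^2(\mathbb R^m\times\mathbb T^n)$ satisfying $$\|e^{it\Delta}P_{\le N}\phi_1\|_{L^p([0,T]\times\mathbb R^m\times\mathbb T^n)}\ge c\,T^{\frac{m+2}{2p}-\frac m4}\,\|\phi_1\|_{L^2(\mathbb R^m\times\mathbb T^n)},$$ $$\|e^{it\Delta}P_{\le N}\phi_2\|_{L^p([0,T]\times\mathbb R^m\times\mathbb T^n)}\ge c\,T^{\frac{m+2}{2p}-\frac m4}\,N^{\frac n2-\frac{n+2}{p}}\,\|\phi_2\|_{L^2(\mathbb R^m\times\mathbb T^n)},$$ $$\|e^{it\Delta}P_{\le N}\phi_3\|_{L^p([0,T]\times\mathbb R^m\times\mathbb T^n)}\ge c\,N^{\frac d2-\frac{d+2}{p}}\,\|\phi_3\|_{L^2(\mathbb R^m\times\mathbb T^n)}.$$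
   Context: $\mathbb T^n=(\mathbb R/\mathbb Z)^n$, and $\Delta$ is the Laplace–Beltrami operator on the waveguide $\mathbb R^m\times\mathbb T^n$, whose frequency space is $\mathbb R^m\times\mathbb Z^n$. $e^{it\Delta}$ is the solution operator of the linear Schrödinger equation $i\partial_t u+\Delta u=0$, a Fourier multiplier (the paper normalizes it by the phase $e^{2\pi i(x\cdot\xi-t|\xi|^2)}$; constant rescalings of time are immaterial). For dyadic $N$, $P_{\le N}$ is the Littlewood–Paley (Fourier) projection to frequencies $|\xi|\lesssim N$. *)

(* Defs.v *)
From HB Require Import structures.
From mathcomp Require Import all_boot all_order all_algebra.
From mathcomp Require Import all_classical all_reals all_analysis.
From mathcomp Require Import complex.

Set Implicit Arguments.
Unset Strict Implicit.
Unset Printing Implicit Defensive.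

Import Order.TTheory GRing.Theory Num.Theory.
Import numFieldNormedType.Exports.

Local Open Scope classical_set_scope.
Local Open Scope ring_scope.
Local Open Scope complex_scope.

(* The library's sigma-finite structure on [m1 \x m2] cannot be inferred: it is
   shadowed by the one for products of subprobabilities. *)
Section product_sfin.
Local Open Scope ereal_scope.
Context d1 d2 (T1 : measurableType d1) (T2 : measurableType d2) (R : realType).
Variable m1 : {sigma_finite_measure set T1 -> \bar R}.
Variable m2 : {sigma_finite_measure set T2 -> \bar R}.

Definition product_sfin : set (T1 * T2) -> \bar R := m1 \x m2.

HB.instance Definition _ := Measure.on product_sfin.

Let product_sfin_sigma_finite : sigma_finite setT product_sfin.
Proof.
have /sigma_finiteP[F [TF ndF Foo]] := sigma_finiteT m1.
have /sigma_finiteP[G [TG ndG Goo]] := sigma_finiteT m2.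
exists (fun n => F n `*` G n) => [|k].
  rewrite -setXTT TF TG predeqE => -[x y]; split=> [|[n _ []/= ? ?]].
    move=> [/= [n _ Fnx] [k _ Gky]]; exists (maxn n k) => //; split.
    - by move: x Fnx; exact/subsetPset/ndF/leq_maxl.
    - by move: y Gky; exact/subsetPset/ndG/leq_maxr.
  by split; exists n.
have [? ?] := Foo k; have [? ?] := Goo k; split; first exact: measurableX.
rewrite /product_sfin product_measure1E//.
by rewrite lte_mul_pinfty// ge0_fin_numE.
Qed.

HB.instance Definition _ :=
  Measure_isSigmaFinite.Build _ _ _ product_sfin product_sfin_sigma_finite.

End product_sfin.

(* Powers of a sigma-finite measure, on the product sigma-algebra of tuples. *)
Section tuple_measure.
Local Open Scope ereal_scope.
Context d (T : measurableType d) (R : realType).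
Variable mu : {sigma_finite_measure set T -> \bar R}.

Definition tuple_cons n (z : T * n.-tuple T) : n.+1.-tuple T :=
  [tuple of z.1 :: z.2].

Lemma measurable_tuple_cons n :
  measurable_fun [set: T * n.-tuple T] (@tuple_cons n).
Proof.
exact: (measurable_cons (f := fst) (g := snd) measurable_fst measurable_snd).
Qed.

Let uncons n (t : n.+1.-tuple T) : T * n.-tuple T :=
  (tnth t ord0, [tuple of behead t]).

Let tuple_consK n : cancel (@tuple_cons n) (@uncons n).
Proof. by case=> x y; congr pair; exact/val_inj. Qed.

Let measurable_uncons n : measurable_fun setT (@uncons n).
Proof.
apply: measurable_fun_pair; first exact: measurable_tnth.
exact: measurable_behead.
Qed.

Section step.
Variables (n : nat) (nu : {sigma_finite_measure set (n.-tuple T) -> \bar R}).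

Definition tuple_measure_step : set (n.+1.-tuple T) -> \bar R :=
  pushforward (product_sfin mu nu) (@tuple_cons n).

Let mcons := @measurable_tuple_cons n.

Let step0 : tuple_measure_step set0 = 0. Proof. exact: measure0. Qed.

Let step_ge0 A : 0 <= tuple_measure_step A. Proof. exact: measure_ge0. Qed.

Let step_sigma_additive : semi_sigma_additive tuple_measure_step.
Proof. exact: measure_semi_sigma_additive. Qed.

HB.instance Definition _ := isMeasure.Build _ _ _ tuple_measure_step
  step0 step_ge0 step_sigma_additive.

Let sigma_finite_step : sigma_finite setT tuple_measure_step.
Proof.
have [F FT Foo] := sigma_finiteT (product_sfin mu nu).
exists (fun k => @uncons n @^-1` F k) => [|k].
  by rewrite -preimage_bigcup -FT preimage_setT.
have [mF Fk] := Foo k; split.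
  by rewrite -[X in measurable X]setTI; exact: measurable_uncons.
rewrite /tuple_measure_step /pushforward -comp_preimage.
by rewrite (_ : _ \o _ = id) //; apply/funext => z; exact: tuple_consK.
Qed.

HB.instance Definition _ :=
  Measure_isSigmaFinite.Build _ _ _ tuple_measure_step sigma_finite_step.

End step.

Fixpoint tuple_measure n : {sigma_finite_measure set (n.-tuple T) -> \bar R} :=
  if n is n'.+1 then tuple_measure_step (tuple_measure n')
  else \d_([tuple] : 0.-tuple T).

End tuple_measure.

Notation Rn R m := (m.-tuple (measurableTypeR R)).

(* Points (x, y) of R^m x T^n, with y given by real coordinates modulo Z^n. *)
Notation waveguide R m n := (Rn R m * Rn R n)%type.

(* Frequencies (xi, k) in R^m x Z^n. *)
Notation frequency R m n := (Rn R m * n.-tuple int)%type.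

Section waveguide_measure.
Context {R : realType}.

Lemma measurable_itvcc (a b : R) : @measurable _ (measurableTypeR R) `[a, b].
Proof. exact: measurable_itv. Qed.

Lemma lebesgue_measure_itvcc_fin (a b : R) :
  (@lebesgue_measure R `[a, b]%classic < +oo)%E.
Proof.
by rewrite lebesgue_measure_itv; case: ifP => // _; rewrite -EFinB ltry.
Qed.

Definition lebesgue_itv (a b : R) :
    {finite_measure set (measurableTypeR R) -> \bar R} :=
  mfrestr (measurable_itvcc a b) (lebesgue_measure_itvcc_fin a b).

Definition lebesgue_Rn m : {sigma_finite_measure set (Rn R m) -> \bar R} :=
  tuple_measure lebesgue_measure m.

(* Haar measure of T^n: Lebesgue measure on the fundamental domain [0, 1]^n. *)
Definition lebesgue_Tn n : {sigma_finite_measure set (Rn R n) -> \bar R} :=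
  tuple_measure (lebesgue_itv 0 1) n.

Definition lebesgue_wg m n :
    {sigma_finite_measure set (waveguide R m n) -> \bar R} :=
  product_sfin (lebesgue_Rn m) (lebesgue_Tn n).

Definition lebesgue_itv_wg (a b : R) m n :
    {sigma_finite_measure
      set (measurableTypeR R * waveguide R m n)%type -> \bar R} :=
  product_sfin (lebesgue_itv a b) (lebesgue_wg m n).

End waveguide_measure.

Section complex_valued.
Context d (T : measurableType d) (R : realType).
Variable mu : {measure set T -> \bar R}.
Implicit Type f : T -> R[i].

Definition cmeasurable f :=
  measurable_fun setT (fun x => complex.Re (f x)) /\
  measurable_fun setT (fun x => complex.Im (f x)).

Definition cintegral f : R[i] :=
  (\int[mu]_x complex.Re (f x)) +i* (\int[mu]_x complex.Im (f x)).

Definition cLnorm (p : R) f : \bar R :=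
  Lnorm mu p%:E (fun x => (ComplexField.Normc.normc (f x))%:E).

End complex_valued.

Section fourier.
Context {R : realType} {m n : nat}.
Implicit Types (z : waveguide R m n) (zeta : frequency R m n).
Implicit Types (phi : waveguide R m n -> R[i]) (g : frequency R m n -> R[i]).

Definition dot l (x y : Rn R l) : R := \sum_(i < l) tnth x i * tnth y i.

Definition int_tuple l (k : l.-tuple int) : Rn R l :=
  [tuple (tnth k i)%:~R | i < l].

Definition translate l (y : Rn R l) (k : l.-tuple int) : Rn R l :=
  [tuple tnth y i + (tnth k i)%:~R | i < l].

Definition wg_periodic phi :=
  forall x y k, phi (x, translate y k) = phi (x, y).

Definition in_Lp (p : R) phi :=
  [/\ wg_periodic phi, cmeasurable phi
    & (cLnorm (lebesgue_wg m n) p phi < +oo)%E].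

Definition e2pi (theta : R) : R[i] :=
  cos (2 * pi * theta) +i* sin (2 * pi * theta).

Definition pairing z zeta : R := dot z.1 zeta.1 + dot z.2 (int_tuple zeta.2).

Definition sqnorm zeta : R :=
  dot zeta.1 zeta.1 + dot (int_tuple zeta.2) (int_tuple zeta.2).

Definition fourier phi zeta : R[i] :=
  cintegral (lebesgue_wg m n) (fun z => phi z * e2pi (- pairing z zeta)).

(* The sum over Z^n is that of a finitely supported family: it is only meant for
   g vanishing when k is outside a finite set, as is any g cut off by P_{<= N}. *)
Definition inv_fourier g z : R[i] :=
  \sum_(k \in [set: n.-tuple int])
    cintegral (lebesgue_Rn m) (fun xi => g (xi, k) * e2pi (pairing z (xi, k))).

(* Squared norm of L^2(R^m x Z^n), for Lebesgue times counting measure. *)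
Definition freq_sqnorm2 g : \bar R :=
  (\esum_(k in [set: n.-tuple int])
    \int[lebesgue_Rn m]_xi ((ComplexField.Normc.normc (g (xi, k)) ^+ 2)%:E))%E.

Definition freq_L2 g :=
  (forall k, cmeasurable (fun xi : Rn R m => g (xi, k))) /\
  (freq_sqnorm2 g < +oo)%E.

(* g is the L^2 (Plancherel) Fourier transform of phi: the continuous extension
   of [fourier] from the intersection of L^1 and L^2. *)
Definition is_fourier_L2 phi g :=
  freq_L2 g /\
  exists f : nat -> waveguide R m n -> R[i],
    [/\ forall j, in_Lp 1 (f j) /\ in_Lp 2 (f j),
        cLnorm (lebesgue_wg m n) 2 (fun z => f j z - phi z)
          @[j --> \oo] --> 0%E
      & freq_sqnorm2 (fun zeta => fourier (f j) zeta - g zeta)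
          @[j --> \oo] --> 0%E].

(* Radial profile of a Littlewood-Paley cutoff. *)
Definition lp_cutoff (eta : R -> R) :=
  [/\ forall k r, derivable (derive1n k eta) r 1,
      forall r, 0 <= eta r <= 1,
      forall r, `|r| <= 1 -> eta r = 1
    & forall r, 2 <= `|r| -> eta r = 0].

Definition lp_multiplier (eta : R -> R) (N : R) zeta : R[i] :=
  (eta (Num.sqrt (sqnorm zeta) / N))%:C.

(* Time is scaled so that (xi, k) carries the phase e^{-2 pi i t |(xi, k)|^2}. *)
Definition schrodinger_multiplier (t : R) zeta : R[i] :=
  e2pi (- (t * sqnorm zeta)).

(* u t z = (e^{it Delta} P_{<= N} phi)(z) for phi in L^2. *)
Definition is_schrodinger_lp (eta : R -> R) (N : R) phi
    (u : R -> waveguide R m n -> R[i]) :=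
  exists2 g, is_fourier_L2 phi g &
    forall t z, u t z = inv_fourier (fun zeta =>
      schrodinger_multiplier t zeta * (lp_multiplier eta N zeta * g zeta)) z.

Definition nonzero_L2 phi :=
  in_Lp 2 phi /\ ~ (\forall z \ae lebesgue_wg m n, phi z = 0).

End fourier.

(* Main.v *)
Require Import Defs.
From HB Require Import structures.
From mathcomp Require Import all_boot all_order all_algebra.
From mathcomp Require Import all_classical all_reals all_analysis.
From mathcomp Require Import measurable_realfun complex ring lra.
Set Implicit Arguments.
Unset Strict Implicit.
Unset Printing Implicit Defensive.
Import Order.TTheory GRing.Theory Num.Theory.
Import numFieldNormedType.Exports.
Local Open Scope classical_set_scope.
Local Open Scope ring_scope.

(**
Take [phi (x, y)] to be a product of tents [tent a x_i] and of exponential sums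
[dirichlet K y_j].  Its Fourier transform is a product of Fejer kernels
[a sinc^2 (a xi_i)], times the indicator of [k in {0, .., K}^n].  It is
nonnegative, so [e^{it Delta} phi] stays comparable to the integral of the
transform wherever the phase [x.xi + y.k - t (|xi|^2 + |k|^2)] is close to an
integer for all [|xi_i| <= M / a] and all such [k]: the mass of the Fejer kernel
outside [-M, M] is a small fraction of the total, uniformly in [a].  As [|k|^2]
is an integer, this happens for [|x_i| <~ a], [y_j <~ 1 / (K + 1)] and [t] within
[1 / (K + 1)^2] of an integer, [t <~ a^2].  Hence
  [|u|_p / |phi|_2 >~ a^(m/p - m/2) (K+1)^(n/2 - n/p) (J tau)^(1/p)]
when [J] intervals of length [tau] of such times are available.  The three waves
are [a ~ sqrt T, K = 0, tau = 1]; [a ~ sqrt T, K ~ N, tau ~ N^-2];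
[a ~ 1 / N, K ~ N, J = 1, tau ~ N^-2]. *)

(** The transform of a compactly supported tent spreads over all of R^m, so part of its mass lies at
    frequencies where neither the phase nor the cutoff [eta] is under control. There only
    [0 <= eta <= 1] and cos >= -1 are available, and the real part of the integrand is at worst
    minus the transform. On the bulk, where [eta] is 1 and the cosine at least 1/2, it is at least
    half the transform. Altogether this leaves bulk / 2 - (total - bulk) = 3/2 bulk - total, and
    [M], which depends on [m] only, is fixed so that this is positive. Nothing else about [eta]
    enters the constants, so [c] can be chosen before it. The tent serves both sides of the
    estimate. It is bounded with compact support, so the wave lies in both L^1 and L^2, and its L^2
    transform is given by the plain integral. It is also the autocorrelation of an interval, up to a
    factor, which makes its transform a square, hence nonnegative. *)

Local Notation normc := ComplexField.Normc.normc.

(** * Integration of complex-valued functions *)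

Section real_product.
Local Open Scope complex_scope.
Context {d1 d2} {T1 : measurableType d1} {T2 : measurableType d2} {R : realType}.
Variables (mu : {sigma_finite_measure set T1 -> \bar R})
  (nu : {sigma_finite_measure set T2 -> \bar R}).

Lemma integrable_prod (f : T1 -> R) (g : T2 -> R) :
  mu.-integrable setT (EFin \o f) -> nu.-integrable setT (EFin \o g) ->
  (product_sfin mu nu).-integrable setT (fun z => (f z.1 * g z.2)%:E).
Proof.
move=> intf intg.
have mf : measurable_fun setT f by apply/measurable_EFinP; exact: measurable_int intf.
have mg : measurable_fun setT g by apply/measurable_EFinP; exact: measurable_int intg.
have mfg : measurable_fun [set: T1 * T2] (fun z => (f z.1 * g z.2)%:E).
  by apply/measurable_EFinP/measurable_funM; exact: measurableT_comp.
apply/(integrable12ltyP mu nu mfg) => /=.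
have -> : (\int[mu]_x \int[nu]_y `|(f x * g y)%:E| =
    (\int[mu]_x `|(f x)%:E|) * (\int[nu]_y `|(g y)%:E|))%E.
  under eq_integral => x _.
    under eq_integral => y _ do rewrite EFinM abseM.
    rewrite ge0_integralZl//; last exact/measurableT_comp/measurable_EFinP.
    over.
  rewrite ge0_integralZr//; last exact: integral_ge0.
  exact/measurableT_comp/measurable_EFinP.
apply: lte_mul_pinfty.
- exact: integral_ge0.
- rewrite ge0_fin_numE; last exact: integral_ge0.
  by case/integrableP : intf.
- by case/integrableP : intg.
Qed.

Lemma Rintegral_prod (f : T1 -> R) (g : T2 -> R) :
  mu.-integrable setT (EFin \o f) -> nu.-integrable setT (EFin \o g) ->
  \int[product_sfin mu nu]_z (f z.1 * g z.2) = \int[mu]_x f x * \int[nu]_y g y.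
Proof.
move=> intf intg; rewrite -RintegralZr// /Rintegral; congr fine.
rewrite -(integral12_prod_meas1 (integrable_prod intf intg))/=.
apply: eq_integral => x _; rewrite /fubini_F/= EFinM.
under eq_integral do rewrite EFinM.
by rewrite integralZl//; congr (_ * _)%E; rewrite fineK//; exact: integrable_fin_num.
Qed.

End real_product.

Section complex_integral.
Local Open Scope complex_scope.
Context {d} {T : measurableType d} {R : realType}.
Variable mu : {measure set T -> \bar R}.
Implicit Types f g : T -> R[i].

Definition cintegrable f :=
  mu.-integrable setT (fun x => (complex.Re (f x))%:E) /\
  mu.-integrable setT (fun x => (complex.Im (f x))%:E).

Lemma complexDE (a b a' b' : R) :
  (a +i* b) + (a' +i* b') = (a + a') +i* (b + b') :> R[i].
Proof. by []. Qed.

Lemma complexME (a b a' b' : R) :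
  (a +i* b) * (a' +i* b') = (a * a' - b * b') +i* (a * b' + b * a') :> R[i].
Proof. by []. Qed.

Lemma complex_ReD (x y : R[i]) : complex.Re (x + y) = complex.Re x + complex.Re y.
Proof. by case: x y => [? ?] []. Qed.

Lemma complex_ImD (x y : R[i]) : complex.Im (x + y) = complex.Im x + complex.Im y.
Proof. by case: x y => [? ?] []. Qed.

Lemma complex_ReM (x y : R[i]) : complex.Re (x * y) =
  complex.Re x * complex.Re y - complex.Im x * complex.Im y.
Proof. by case: x y => [? ?] []. Qed.

Lemma complex_ImM (x y : R[i]) : complex.Im (x * y) =
  complex.Re x * complex.Im y + complex.Im x * complex.Re y.
Proof. by case: x y => [? ?] []. Qed.

Lemma cintegrable_cmeasurable f : cintegrable f -> cmeasurable f.
Proof.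
by move=> [? ?]; split; apply/measurable_EFinP; exact: (measurable_int mu).
Qed.

Lemma cintegrable_real (f : T -> R) :
  mu.-integrable setT (EFin \o f) -> cintegrable (fun x => (f x)%:C).
Proof. by move=> intf; split=> //; exact: integrable0. Qed.

Lemma cintegral_real (f : T -> R) :
  cintegral mu (fun x => (f x)%:C) = (\int[mu]_x f x)%:C.
Proof.
rewrite /cintegral/= /real_complex_def; congr Complex.
by rewrite /Rintegral integral0.
Qed.

Lemma cintegrable_sum (I : Type) (s : seq I) (F : I -> T -> R[i]) :
  (forall i, cintegrable (F i)) -> cintegrable (fun x => \sum_(i <- s) F i x).
Proof.
move=> intF; elim: s => [|i s [ihR ihI]].
  by split; under eq_fun do rewrite big_nil; exact: integrable0.
split; under eq_fun do rewrite big_cons ?complex_ReD ?complex_ImD EFinD.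
- by apply: integrableD => //; exact: (intF i).1.
- by apply: integrableD => //; exact: (intF i).2.
Qed.

Lemma cintegral_sum (I : Type) (s : seq I) (F : I -> T -> R[i]) :
  (forall i, cintegrable (F i)) ->
  cintegral mu (fun x => \sum_(i <- s) F i x) = \sum_(i <- s) cintegral mu (F i).
Proof.
move=> intF; elim: s => [|i s ih].
  rewrite big_nil /cintegral; congr Complex;
  by under eq_Rintegral do rewrite big_nil; rewrite /Rintegral integral0.
have [ReF ImF] := cintegrable_sum s intF.
rewrite big_cons -ih /cintegral complexDE; congr Complex.
- under eq_Rintegral do rewrite big_cons complex_ReD.
  by rewrite RintegralD//; exact: (intF i).1.
- under eq_Rintegral do rewrite big_cons complex_ImD.
  by rewrite RintegralD//; exact: (intF i).2.
Qed.

Lemma cintegrableM_bounded (f g : T -> R[i]) (M : R) :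
  cintegrable f -> cmeasurable g ->
  (forall x, `|complex.Re (g x)| <= M /\ `|complex.Im (g x)| <= M) ->
  cintegrable (fun x => f x * g x).
Proof.
move=> [Rf If] [mRg mIg] gM.
have aux (h k : T -> R) : mu.-integrable setT (EFin \o h) -> measurable_fun setT k ->
    (forall x, `|k x| <= M) -> mu.-integrable setT (fun x => (h x * k x)%:E).
  move=> ih mk kM.
  have mh : measurable_fun setT h by apply/measurable_EFinP; exact: measurable_int ih.
  apply: (@le_integrable _ _ _ mu setT measurableT _ (fun x => M%:E * (h x)%:E)%E).
  - exact/measurable_EFinP/measurable_funM.
  - move=> x _; rewrite -EFinM !abse_EFin lee_fin normrM normrM mulrC.
    by rewrite ler_wpM2r// (le_trans (kM x))// ler_norm.
  - exact: integrableZl.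
split; under eq_fun do rewrite ?complex_ReM ?complex_ImM ?EFinB ?EFinD.
- by apply: integrableB => //; apply: aux => // x; have [] := gM x.
- by apply: integrableD => //; apply: aux => // x; have [] := gM x.
Qed.

End complex_integral.

(** * Fubini for products of one-variable functions *)

Section complex_product.
Local Open Scope complex_scope.
Context {R : realType}.

Section pair.
Context {d1 d2} {T1 : measurableType d1} {T2 : measurableType d2}.
Variables (mu : {sigma_finite_measure set T1 -> \bar R})
  (nu : {sigma_finite_measure set T2 -> \bar R}).

Lemma cintegrable_prod (f : T1 -> R[i]) (g : T2 -> R[i]) :
  cintegrable mu f -> cintegrable nu g ->
  cintegrable (product_sfin mu nu) (fun z => f z.1 * g z.2).
Proof.
move=> [Rf If] [Rg Ig]; split; under eq_fun do rewrite ?complex_ReM ?complex_ImM ?EFinB ?EFinD.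
- by apply: integrableB => //; [exact: integrable_prod Rf Rg|exact: integrable_prod If Ig].
- by apply: integrableD => //; [exact: integrable_prod Rf Ig|exact: integrable_prod If Rg].
Qed.

Lemma cintegral_prod (f : T1 -> R[i]) (g : T2 -> R[i]) :
  cintegrable mu f -> cintegrable nu g ->
  cintegral (product_sfin mu nu) (fun z => f z.1 * g z.2) =
  cintegral mu f * cintegral nu g.
Proof.
move=> [Rf If] [Rg Ig]; rewrite /cintegral complexME; congr Complex.
- under eq_Rintegral do rewrite complex_ReM.
  rewrite RintegralB//; [|exact: integrable_prod Rf Rg|exact: integrable_prod If Ig].
  by rewrite (Rintegral_prod Rf Rg) (Rintegral_prod If Ig).
- under eq_Rintegral do rewrite complex_ImM.
  rewrite RintegralD//; [|exact: integrable_prod Rf Ig|exact: integrable_prod If Rg].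
  by rewrite (Rintegral_prod Rf Ig) (Rintegral_prod If Rg).
Qed.

End pair.

Section tuple.
Context {d} {T : measurableType d}.
Variable mu : {sigma_finite_measure set T -> \bar R}.

Lemma tuple_consE n (f : 'I_n.+1 -> T -> R[i]) (z : T * n.-tuple T) :
  \prod_i f i (tnth (tuple_cons z) i) =
  f ord0 z.1 * \prod_(i < n) f (lift ord0 i) (tnth z.2 i).
Proof.
case: z => x t; rewrite big_ord_recl/= tnth0.
by congr (_ * _); apply: eq_bigr => i _; rewrite tnthS.
Qed.

Lemma cmeasurable_tuple_prod n (f : 'I_n -> T -> R[i]) :
  (forall i, cmeasurable (f i)) ->
  cmeasurable (fun x : n.-tuple T => \prod_i f i (tnth x i)).
Proof.
have mm (I : Type) (s : seq I) (F : I -> n.-tuple T -> R[i]) :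
    (forall i, cmeasurable (F i)) -> cmeasurable (fun x => \prod_(i <- s) F i x).
  move=> mF; elim: s => [|i s [ihR ihI]].
    by split; under eq_fun do rewrite big_nil; exact: measurable_cst.
  have [mR mI] := mF i.
  split; under eq_fun do rewrite big_cons ?complex_ReM ?complex_ImM.
    by apply: measurable_funB; apply: measurable_funM.
  by apply: measurable_funD; apply: measurable_funM.
move=> mf; apply: mm => i; have [mR mI] := mf i.
by split; apply: (measurableT_comp (f := fun x => _ (f i x))) => //; exact: measurable_tnth.
Qed.

(** By induction: the measure on [n.+1]-tuples is the image of a product measure under [tuple_cons],
    so the head factor splits off; at length 0 it is the Dirac mass at the empty tuple and both
    sides are 1. The factors depend on the index so that they can absorb a character with a
    different frequency in each coordinate. *)
Lemma tuple_prod n (f : 'I_n -> T -> R[i]) :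
  (forall i, cintegrable mu (f i)) ->
  cintegrable (tuple_measure mu n) (fun x => \prod_i f i (tnth x i)) /\
  cintegral (tuple_measure mu n) (fun x => \prod_i f i (tnth x i)) =
  \prod_i cintegral mu (f i).
Proof.
elim: n f => [|n ih] f intf.
  under [in X in X /\ _]eq_fun do rewrite big_ord0.
  under [in X in _ /\ X]eq_fun do rewrite big_ord0.
  rewrite big_ord0; split.
    split; apply/integrableP; split; first exact: measurable_cst.
      by rewrite integral_dirac// diracT mul1e abse_EFin ltry.
      exact: measurable_cst.
      by rewrite integral_dirac// diracT mul1e abse_EFin ltry.
  rewrite /cintegral/=; congr Complex;
  by rewrite /Rintegral integral_dirac// diracT mul1e.
have [iF EF] := ih (fun i => f (lift ord0 i)) (fun i => intf _).
have mf : cmeasurable (fun x : n.+1.-tuple T => \prod_i f i (tnth x i)).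
  by apply: cmeasurable_tuple_prod => i; exact: cintegrable_cmeasurable.
have [iR iI] := cintegrable_prod (intf ord0) iF.
have iR' : (product_sfin mu (tuple_measure mu n)).-integrable
   (@tuple_cons _ T n @^-1` setT)
   ((fun x => (complex.Re (\prod_i f i (tnth x i)))%:E) \o @tuple_cons _ T n).
  by rewrite preimage_setT; apply: eq_integrable iR => // z _ /=; rewrite tuple_consE.
have iI' : (product_sfin mu (tuple_measure mu n)).-integrable
   (@tuple_cons _ T n @^-1` setT)
   ((fun x => (complex.Im (\prod_i f i (tnth x i)))%:E) \o @tuple_cons _ T n).
  by rewrite preimage_setT; apply: eq_integrable iI => // z _ /=; rewrite tuple_consE.
have [/measurable_EFinP mR /measurable_EFinP mI] := mf.
have mc := @measurable_tuple_cons _ T n.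
split.
  by split; apply: (integrable_pushforward mc).
rewrite big_ord_recl -EF -cintegral_prod//.
rewrite /cintegral; congr Complex.
- rewrite /Rintegral (integral_pushforward mc mR iR')// preimage_setT; congr fine.
  by apply: eq_integral => z _; rewrite /= tuple_consE.
- rewrite /Rintegral (integral_pushforward mc mI iI')// preimage_setT; congr fine.
  by apply: eq_integral => z _; rewrite /= tuple_consE.
Qed.

End tuple.

End complex_product.

(** * Restriction, reflection and dilation of Lebesgue measure on the line *)

Section restricted_measure.
Local Open Scope complex_scope.
Context {R : realType}.
Implicit Type f : measurableTypeR R -> R.

(** The complement of [[a, b]] is null for the trace measure, so [f] may be cut off there; inside
    [[a, b]] the two measures agree. *)
Lemma integral_lebesgue_itv (a b : R) (f : measurableTypeR R -> \bar R) :
  measurable_fun setT f ->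
  (\int[lebesgue_itv a b]_x f x = \int[lebesgue_measure]_(x in `[a, b]) f x)%E.
Proof.
move=> mf; have mab : measurable (`[a, b] : set (measurableTypeR R)).
  exact: measurable_itv.
rewrite (@ae_eq_integral _ _ _ (lebesgue_itv a b) setT (f \_ `[a, b]) f)//.
- rewrite -integral_mkcond; apply: eq_measure_integral => A mA Aab.
  by rewrite /= /mfrestr /mrestr setIidl.
- by apply/(measurable_restrictT f mab); exact: measurable_funS mf.
- exists (~` `[a, b]); split; first exact: measurableC.
    by rewrite /= /mfrestr /mrestr setICl measure0.
  move=> x /= /not_implyP[_]; apply: contra_not => xab.
  by rewrite patchE mem_set.
Qed.

Lemma Rintegral_lebesgue_itv (a b : R) f : measurable_fun setT f ->
  \int[lebesgue_itv a b]_x f x = \int[lebesgue_measure]_(x in `[a, b]) f x.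
Proof.
by move=> mf; rewrite /Rintegral integral_lebesgue_itv//; exact/measurable_EFinP.
Qed.

Lemma integrable_bounded_itv (a b M : R) f : measurable_fun setT f ->
  (forall x, `|f x| <= M) -> (lebesgue_itv a b).-integrable setT (EFin \o f).
Proof.
move=> mf fM; apply: measurable_bounded_integrable => //.
  by rewrite -ge0_fin_numE//; exact: fin_num_measure.
exists M; split; first exact: num_real.
by move=> y My x _; apply: le_trans (fM x) _; exact: ltW.
Qed.

Lemma Rintegral_fold f :
  (@lebesgue_measure R).-integrable setT (EFin \o f) ->
  \int[lebesgue_measure]_x f x = \int[lebesgue_measure]_(x in `[0, +oo[) (f x + f (- x)).
Proof.
move=> intf.
have mN : measurable_fun [set: measurableTypeR R] (-%R : measurableTypeR R -> measurableTypeR R).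
  exact: oppr_measurable.
have mf : measurable_fun setT f by apply/measurable_EFinP; exact: measurable_int intf.
have intfN : (@lebesgue_measure R).-integrable setT (fun x => (f (- x))%:E).
  apply/integrableP; split; first by apply/measurable_EFinP; exact: measurableT_comp.
  have /integrableP[_] := intf; apply: le_lt_trans.
  rewrite (eq_measure_integral (pushforward (@lebesgue_measure R)
  (-%R : _ -> measurableTypeR R))); last first.
    by move=> A mA _; exact/esym/lebesgue_measureN.
  rewrite ge0_integral_pushforward//.
    rewrite preimage_setT; rewrite le_eqVlt; apply/orP; left; apply/eqP.
    by apply: eq_integral => x _; rewrite /= opprK.
  apply: measurableT_comp => //; apply/measurable_EFinP.
  exact: measurableT_comp.
have mi (i : interval R) : measurable ([set` i] : set (measurableTypeR R)) by exact: measurable_itv.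
rewrite -[in LHS]set_itvNyy (@itv_bndbnd_setU _ _ _ (BLeft 0))//.
rewrite Rintegral_setU//; last 2 first.
- by rewrite -itv_bndbnd_setU//; apply: integrableS intf.
- apply/disj_setPS => x [/=]; rewrite !in_itv/= andbT => x0.
  by rewrite leNgt x0.
rewrite RintegralD//; last 2 first.
- exact: integrableS intf.
- exact: integrableS intfN.
rewrite addrC; congr (_ + _).
(* The reflection of []-oo, 0[] is the open half-line, so the null endpoint 0 has to be dropped. *)
rewrite -Rintegral_itv_obnd_cbnd; last exact: integrableS intfN.
rewrite /Rintegral; congr fine.
rewrite (eq_measure_integral (pushforward (@lebesgue_measure R)
  (-%R : _ -> measurableTypeR R))); last first.
  by move=> A mA _; exact/esym/lebesgue_measureN.
have -> : `]0, +oo[%classic = (-%R : measurableTypeR R -> measurableTypeR R) @^-1` `]-oo, 0[.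
  by apply/seteqP; split=> x /=; rewrite !in_itv/= ?andbT oppr_lt0.
rewrite (integral_pushforward mN)//; first exact/measurable_EFinP.
apply: (integrableS measurableT _ _ intfN) => //.
by rewrite -[X in measurable X]setTI; exact: mN.
Qed.

(** By uniqueness of Lebesgue measure: [a] times its image under multiplication by [a] gives
    half-open intervals their length. *)
Lemma ge0_integral_scale (a : R) (f : measurableTypeR R -> \bar R) : 0 < a ->
  measurable_fun setT f -> (forall x, 0 <= f x)%E ->
  (\int[lebesgue_measure]_x f x = a%:E * \int[lebesgue_measure]_x f (a * x)%R)%E.
Proof.
move=> a0 mf f0.
have ma : measurable_fun [set: measurableTypeR R] (fun x => a * x : measurableTypeR R).
  exact: measurable_funM.
pose aN : {nonneg R} := NngNum (ltW a0).
rewrite (eq_measure_integral (mscale aN (pushforward (@lebesgue_measure R)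
  (fun x => a * x : measurableTypeR R)))).
  rewrite ge0_integral_mscale// ge0_integral_pushforward//.
move=> A mA _.
apply: (lebesgue_measure_unique (mu := mscale aN (pushforward
  (@lebesgue_measure R) (fun x => a * x : measurableTypeR R)))) => // _ [[b c]] _ <-.
transitivity (a%:E * @lebesgue_measure R ((fun x => a * x)%R @^-1` `]b, c]))%E; last by [].
rewrite (_ : _ @^-1` _ = `]a^-1 * b, a^-1 * c]%classic); last first.
  apply/seteqP; split=> x /=; rewrite !in_itv/=.
    by rewrite ltr_pdivrMl// ler_pdivlMl.
  by rewrite ltr_pdivrMl// ler_pdivlMl.
rewrite !lebesgue_measure_itv/= !lte_fin ltr_pM2l ?invr_gt0//.
case: ifPn => _; last by rewrite mule0.
by rewrite -EFinM -mulrBr mulrA divff ?mul1r ?gt_eqF.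
Qed.

End restricted_measure.

(** * The tent function and its Fourier transform *)

Section calculus.
Local Open Scope complex_scope.
Context {R : realType}.

Lemma Rintegral_FTC (f F : R -> R) (a b : R) : a < b -> continuous f ->
  (forall x : R, is_derive x 1 F (f x)) ->
  \int[lebesgue_measure]_(x in `[a, b]) f x = F b - F a.
Proof.
move=> ab cf dF; have dvF (x : R) : derivable F x 1 by case: (dF x).
have cF : continuous F by move=> x; exact/differentiable_continuous/derivable1_diffP.
rewrite /Rintegral (@continuous_FTC2 _ f F a b)//.
- exact: continuous_subspaceT.
- split.
  + by move=> x _.
  + by apply: cvg_at_right_filter; exact: cF.
  + by apply: cvg_at_left_filter; exact: cF.
- by move=> x _; rewrite derive1E; case: (dF x).
Qed.

Lemma is_derive1B (f g : R -> R) (x df dg : R) :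
  is_derive x 1 f df -> is_derive x 1 g dg ->
  is_derive x 1 (fun y => f y - g y) (df - dg).
Proof. by move=> ? ?; exact: is_deriveB. Qed.

Lemma is_derive1M (f g : R -> R) (x df dg : R) :
  is_derive x 1 f df -> is_derive x 1 g dg ->
  is_derive x 1 (fun y => f y * g y) (f x * dg + g x * df).
Proof. by move=> ? ?; exact: is_deriveM. Qed.

Lemma is_derive1Z (f : R -> R) (k x df : R) :
  is_derive x 1 f df -> is_derive x 1 (fun y => k * f y) (k * df).
Proof. by move=> ?; exact: is_deriveZ. Qed.

Lemma is_derive1_scale (w x : R) : is_derive x 1 (fun y : R => w * y) w.
Proof. by have := is_derive1Z w (is_derive_id x 1); rewrite mulr1. Qed.

Lemma is_derive_sin_scale (w x : R) :
  is_derive x 1 (fun y => sin (w * y)) (w * cos (w * x)).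
Proof.
have := is_derive1_comp (is_derive_sin (w * x)) (is_derive1_scale w x).
by rewrite mulrC.
Qed.

Lemma is_derive_cos_scale (w x : R) :
  is_derive x 1 (fun y => cos (w * y)) (- (w * sin (w * x))).
Proof.
have := is_derive1_comp (is_derive_cos (w * x)) (is_derive1_scale w x).
by rewrite mulrC mulrN.
Qed.

Lemma continuous_sin_scale (w : R) : continuous (fun y => sin (w * y)).
Proof.
move=> x; apply/differentiable_continuous/derivable1_diffP.
by case: (is_derive_sin_scale w x).
Qed.

Lemma continuous_cos_scale (w : R) : continuous (fun y => cos (w * y)).
Proof.
move=> x; apply/differentiable_continuous/derivable1_diffP.
by case: (is_derive_cos_scale w x).
Qed.

(** This is [a^-1] times the convolution of the indicator of [[-a/2, a/2]] with itself, hence a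
    transform of the form [a sinc^2 (a xi)]. *)
Definition tent (a x : R) : R := Num.max 0 (1 - `|x| / a).

(* The Fourier transform sinc^2 of [tent 1], with sinc^2(xi) written through
   sin^2 = (1 - cos) / 2. *)
Definition fejer (xi : R) : R :=
  if xi == 0 then 1 else 2 * (1 - cos (2 * pi * xi)) / (2 * pi * xi) ^+ 2.

Lemma tent_ge0 a x : 0 <= tent a x.
Proof. by rewrite le_max lexx. Qed.

Lemma tent_le1 a x : 0 < a -> tent a x <= 1.
Proof.
by move=> a0; rewrite ge_max ler01/= gerBl divr_ge0// ltW.
Qed.

Lemma tent_out a x : 0 < a -> a <= `|x| -> tent a x = 0.
Proof.
by move=> a0 ax; apply/max_idPl; rewrite subr_le0 ler_pdivlMr// mul1r.
Qed.

Lemma tentN a x : tent a (- x) = tent a x.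
Proof. by rewrite /tent normrN. Qed.

Lemma measurable_tent a : measurable_fun setT (tent a : measurableTypeR R -> R).
Proof.
apply: measurable_maxr => //; apply: measurable_funB => //.
by apply: measurable_funM => //; exact: measurable_normr.
Qed.

Lemma integrable_tent a : 0 < a ->
  (@lebesgue_measure R).-integrable setT (EFin \o tent a).
Proof.
move=> a0; apply: (le_integrable measurableT _ _ (integrable_indic_itv (- a) a true false)) => /=.
  by apply/measurable_EFinP; exact: measurable_tent.
move=> x _; rewrite lee_fin ger0_norm ?tent_ge0// indicE.
have [xa|xa] := boolP (_ \in _); first by rewrite normr1 tent_le1.
rewrite normr0 tent_out//; rewrite leNgt; apply: contra xa.
by rewrite inE/= in_itv/= ltr_norml => /andP[/ltW -> /ltW ->].
Qed.

Lemma integrable_tentM a (k : measurableTypeR R -> R) : 0 < a -> measurable_fun setT k ->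
  (forall x, `|k x| <= 1) ->
  (@lebesgue_measure R).-integrable setT (fun x => (tent a x * k x)%:E).
Proof.
move=> a0 mk k1; apply: (le_integrable measurableT _ _ (integrable_tent a0)) => /=.
  by apply/measurable_EFinP/measurable_funM => //; exact: measurable_tent.
move=> x _; rewrite lee_fin normrM.
by rewrite ler_piMr.
Qed.

Lemma Rintegral_tent_cos a w : 0 < a ->
  \int[lebesgue_measure]_x (tent a x * cos (w * x)) =
  if w == 0 then a else 2 * (1 - cos (w * a)) / (a * w ^+ 2).
Proof.
move=> a0; rewrite Rintegral_fold; last first.
  apply: integrable_tentM => //; last by move=> x; exact: cos_max.
  by apply: continuous_measurable_fun; exact: continuous_cos_scale.
transitivity (\int[lebesgue_measure]_(x in `[0, a]) (2 * ((1 - x / a) * cos (w * x)))).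
  rewrite Rintegral_mkcond [RHS]Rintegral_mkcond; congr (Rintegral _ _ _).
  apply/funext => x; rewrite !patchE mem_setE in_itv/= andbT mem_setE in_itv/=.
  case: (leP 0 x) => //= x0.
  rewrite tentN mulrN cosN -mulr2n mulr_natl; case: leP => xa.
    rewrite /tent ger0_norm// (max_idPr _)// subr_ge0 ler_pdivrMr// mul1r//.
  by rewrite tent_out ?mul0r ?mul0rn// ger0_norm// ltW.
have cf (f g : R -> R) : continuous f -> continuous g -> continuous (fun x => f x * g x).
  by move=> cf cg x; apply: continuousM; [exact: cf|exact: cg].
have dl (x : R) : is_derive x 1 (fun y : R => 1 - a^-1 * y) (0 - a^-1).
  have h := is_derive1B (is_derive_cst (1 : R) x 1) (is_derive1_scale a^-1 x). exact h.
have cl : continuous (fun x : R => 1 - x / a).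
  have -> : (fun x : R => 1 - x / a) = (fun x => 1 - a^-1 * x).
    by apply/funext => x; rewrite mulrC.
  by move=> x; apply/differentiable_continuous/derivable1_diffP; case: (dl x).
have cl2 : continuous (fun x : R => 2 * ((1 - x / a) * cos (w * x))).
  apply: (cf (cst 2)); first exact: cst_continuous.
  by apply: cf => //; exact: continuous_cos_scale.
case: eqVneq => [w0|w0].
  have d2 (x : R) : is_derive x 1 (fun x => 2 * x - a^-1 * (x * x)) (2 * ((1 - x / a) * cos (w * x))).
    have d2 := is_derive1Z a^-1 (is_derive1M (is_derive_id x 1) (is_derive_id x 1)).
    apply: (is_derive_eq (is_derive1B (is_derive1_scale 2 x) d2)).
    by rewrite w0 mul0r cos0 /=; field; rewrite gt_eqF.
  by rewrite (Rintegral_FTC a0 cl2 d2); field; rewrite gt_eqF.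
(* The primitive comes from one integration by parts; the case [w = 0] above had a polynomial
   primitive. *)
have d2 (x : R) : is_derive x 1 (fun x => 2 * (w^-1 * ((1 - a^-1 * x) * sin (w * x))
    - (a * w ^+ 2)^-1 * cos (w * x))) (2 * ((1 - x / a) * cos (w * x))).
  have ds := is_derive_sin_scale w x; have dc := is_derive_cos_scale w x.
  apply: (is_derive_eq (is_derive1Z 2 (is_derive1B
    (is_derive1Z w^-1 (is_derive1M (dl x) ds)) (is_derive1Z (a * w ^+ 2)^-1 dc)))).
  by field; rewrite w0 gt_eqF.
by rewrite (Rintegral_FTC a0 cl2 d2) !mulr0 sin0 cos0; field; rewrite w0 gt_eqF.
Qed.

End calculus.

(** * The Fejer kernel: bounds, integrability, concentration of its mass *)

Section fejer.
Local Open Scope complex_scope.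
Context {R : realType}.
Local Notation mu := (@lebesgue_measure R).

Lemma e2piD (x y : R) : e2pi (x + y) = e2pi x * e2pi y.
Proof.
by rewrite /e2pi complexME mulrDr cosD sinD [in X in _ +i* X]addrC.
Qed.

Lemma e2pi0 : e2pi (0 : R) = 1.
Proof. by rewrite /e2pi mulr0 cos0 sin0. Qed.

Lemma e2pi_sum (I : Type) (s : seq I) (F : I -> R) :
  e2pi (\sum_(i <- s) F i) = \prod_(i <- s) e2pi (F i).
Proof. by apply: (big_morph e2pi e2piD e2pi0). Qed.

Lemma e2pi_int (k : int) : e2pi (k%:~R : R) = 1.
Proof.
have nat1 (n : nat) : e2pi (n%:R : R) = 1.
  elim: n => [|n ih]; first exact: e2pi0.
  rewrite -natr1 e2piD ih mul1r /e2pi mulr1 mulrC mulr_natr.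
  by rewrite cos2pi sin2pi.
case: k => n; first exact: nat1.
rewrite NegzE mulrNz -[RHS](nat1 n.+1).
by rewrite -[RHS]mul1r -[X in X * _]e2pi0 -e2piD add0r -[LHS]mulr1 -(nat1 n.+1) -e2piD addNr e2pi0 nat1.
Qed.

Lemma e2piN (x : R) : e2pi (- x) = (e2pi x)^*.
Proof. by rewrite /e2pi mulrN cosN sinN. Qed.

Lemma e2pi_bounded (x : R) :
  `|complex.Re (e2pi x)| <= 1 /\ `|complex.Im (e2pi x)| <= 1.
Proof. by split; [exact: cos_max|exact: sin_max]. Qed.

Lemma cmeasurable_e2pi d (T : measurableType d) (f : T -> R) :
  measurable_fun setT f -> cmeasurable (fun x => e2pi (f x)).
Proof.
move=> mf; split.
- apply: (measurableT_comp (f := fun x : R => cos (2 * pi * x))) => //.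
  by apply: continuous_measurable_fun; exact: continuous_cos_scale.
- apply: (measurableT_comp (f := fun x : R => sin (2 * pi * x))) => //.
  by apply: continuous_measurable_fun; exact: continuous_sin_scale.
Qed.

Lemma fejer_scaleE (a xi : R) : 0 < a ->
  \int[mu]_x (tent a x * cos (2 * pi * xi * x)) = a * fejer (a * xi).
Proof.
move=> a0; rewrite Rintegral_tent_cos// /fejer.
have p0 : (pi : R) != 0 by rewrite gt_eqF// pi_gt0.
have -> : (2 * pi * xi == 0) = (xi == 0).
  by rewrite !mulf_eq0 (negbTE p0) pnatr_eq0.
have -> : (a * xi == 0) = (xi == 0) by rewrite mulf_eq0 gt_eqF.
case: eqVneq => [_|x0]; first by rewrite mulr1.
have -> : 2 * pi * xi * a = 2 * pi * (a * xi) by rewrite mulrAC !mulrA.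
by move: p0; generalize (pi : R) => q q0; field; rewrite x0 q0 gt_eqF.
Qed.

Lemma tent_cintegrable (a xi : R) : 0 < a ->
  cintegrable mu (fun x => (tent a x)%:C * e2pi (- (x * xi))).
Proof.
move=> a0; apply: (cintegrableM_bounded (M := 1)).
- by apply: cintegrable_real; exact: integrable_tent.
- apply: cmeasurable_e2pi; apply: measurableT_comp => //.
  exact: measurable_funM.
- by move=> x; exact: e2pi_bounded.
Qed.

(** The tent is even: the real part is its cosine transform, and the odd imaginary part folds to
    0. *)
Lemma fourier_tent (a xi : R) : 0 < a ->
  cintegral mu (fun x => (tent a x)%:C * e2pi (- (x * xi))) =
  (a * fejer (a * xi))%:C.
Proof.
move=> a0; rewrite -fejer_scaleE// /cintegral /real_complex_def; congr Complex.
  apply: eq_Rintegral => x _; rewrite complex_ReM /= mul0r subr0.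
  by rewrite mulrN cosN [x * xi]mulrC mulrA.
have [_ iI] := tent_cintegrable xi a0.
rewrite Rintegral_fold//; transitivity (\int[mu]_(x in `[0, +oo[) (0:R)).
  apply: eq_Rintegral => x _; rewrite !complex_ImM /= !mul0r !addr0 tentN.
  by rewrite mulNr opprK !mulrN sinN mulrN addNr.
by rewrite /Rintegral integral0.
Qed.

Lemma fejer_ge0 (xi : R) : 0 <= fejer xi.
Proof.
rewrite /fejer; case: ifP => // _.
by rewrite divr_ge0 ?sqr_ge0// mulr_ge0// subr_ge0 cos_le1.
Qed.

(** As the cosine transform of the nonnegative [tent 1], [fejer] is largest at frequency 0, where it
    equals 1. *)
Lemma fejer_le1 (xi : R) : fejer xi <= 1.
Proof.
have tE (x : R) : (1 : R) * fejer (1 * x) = fejer x by rewrite !mul1r.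
rewrite -tE -fejer_scaleE//.
have e1 : \int[mu]_x (tent 1 x * cos (2 * pi * 0 * x)) = 1.
  by rewrite fejer_scaleE// tE /fejer eqxx.
rewrite -[leRHS]e1.
have itc (w : R) : mu.-integrable setT (fun x => (tent 1 x * cos (w * x))%:E).
  apply: integrable_tentM => //; last by move=> x; exact: cos_max.
  by apply: continuous_measurable_fun; exact: continuous_cos_scale.
apply: le_Rintegral => //; [exact: itc|exact: itc|].
move=> x _; rewrite mulr0 mul0r cos0 ler_wpM2l ?tent_ge0//.
Qed.

(** The numerator is at most 4, and the denominator at least [4 xi^2] because [pi >= 1]. *)
Lemma fejer_le_sqrV (xi : R) : xi != 0 -> fejer xi <= xi ^- 2.
Proof.
move=> x0; rewrite /fejer (negbTE x0).
have p1 : 1 <= (pi : R) by rewrite (le_trans _ (pi_ge2 R)) ?ler1n.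
have p0 : (pi : R) != 0 by rewrite gt_eqF// pi_gt0.
have x2 : 0 < xi ^+ 2 by rewrite exprn_even_gt0.
have d0 : 0 < 2 ^+ 2 * pi ^+ 2 * xi ^+ 2 :> R.
  by apply: mulr_gt0 => //; apply: mulr_gt0; rewrite exprn_gt0// pi_gt0.
rewrite !exprMn ler_pdivrMr//.
have -> : xi ^- 2 * (2 ^+ 2 * pi ^+ 2 * xi ^+ 2) = 4 * (pi * pi).
  by move: p0; generalize (pi : R) => q _; field.
have c1 := cos_geN1 (2 * pi * xi).
have p2 : 1 <= (pi : R) * pi by rewrite (le_trans p1)// ler_peMl// (le_trans _ p1).
lra.
Qed.

Lemma measurable_fejer : measurable_fun setT (fejer : measurableTypeR R -> R).
Proof.
apply: measurable_fun_ifT => //.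
  by apply: measurable_fun_eqr.
have -> : (fun xi : R => 2 * (1 - cos (2 * pi * xi)) / (2 * pi * xi) ^+ 2) =
    (fun xi => 2 * (1 - cos (2 * pi * xi)) * ((2 * pi * xi) ^+ 2) `^ (-1)).
  by apply/funext => xi; rewrite powR_inv1// sqr_ge0.
apply: measurable_funM.
  apply: measurable_funM => //; apply: measurable_funB => //.
  by apply: continuous_measurable_fun; exact: continuous_cos_scale.
apply: (measurableT_comp (f := fun y : R => y `^ (-1))); first exact: measurable_powR.
by apply: measurable_funX; exact: measurable_funM.
Qed.

Lemma integrable_oneDsqrV : mu.-integrable setT (fun x => (2 * (oneDsqr x)^-1)%:E).
Proof.
apply/integrableP; split.
  apply/measurable_EFinP; apply: measurable_funM => //.
  by apply: continuous_measurable_fun; exact: continuous_oneDsqrV.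
under eq_integral => x _ do rewrite abse_EFin ger0_norm ?mulr_ge0// EFinM.
rewrite ge0_integralZl//; last first.
  apply/measurable_EFinP.
  by apply: continuous_measurable_fun; exact: continuous_oneDsqrV.
rewrite ge0_symfun_integralT//.
- by rewrite -set_itvcy integral0y_oneDsqr -!EFinM ltry.
- exact: continuous_oneDsqrV.
- by move=> x; rewrite /oneDsqr/= sqrrN.
Qed.

(** The bounds [fejer <= 1] and [xi^2 fejer <= 1] add up to domination by [2 / (1 + xi^2)]. *)
Lemma integrable_fejer : mu.-integrable setT (EFin \o fejer).
Proof.
apply: le_integrable integrable_oneDsqrV => //.
  by apply/measurable_EFinP; exact: measurable_fejer.
move=> x _; rewrite lee_fin !ger0_norm ?mulr_ge0 ?fejer_ge0//.
rewrite ler_pdivlMr ?oneDsqr_gt0// /oneDsqr mulrDr mulr1.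
have [->|x0] := eqVneq x 0; first by rewrite expr0n/= mulr0 addr0 (le_trans (fejer_le1 _))// ler1n.
rewrite -[2]/(1 + 1) lerD ?fejer_le1// -ler_pdivlMr ?exprn_even_gt0// mul1r.
exact: fejer_le_sqrV.
Qed.

(** On this range the angle [2 pi xi] lies in [[pi/2, pi]], where the cosine is nonpositive: the
    numerator is at least 2 and the denominator at most [pi^2]. This gives the kernel a positive
    mass. *)
Lemma fejer_ge (xi : R) : 4^-1 <= xi <= 2^-1 -> 2 / pi ^+ 2 <= fejer xi.
Proof.
move=> /andP[x1 x2].
have x0 : 0 < xi by rewrite (lt_le_trans _ x1)// invr_gt0.
have p0 : 0 < (pi : R) := pi_gt0 R.
rewrite /fejer gt_eqF//.
have c0 : cos (2 * pi * xi) <= 0.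
  rewrite -[X in cos X](subrK (pi / 2)) cosDpihalf oppr_le0 sin_ge0_pi//.
  apply/andP; split.
    rewrite subr_ge0; nra.
  nra.
have w1 : (2 * pi * xi) ^+ 2 <= pi ^+ 2.
  apply: lerXn2r; rewrite ?nnegrE ?(ltW p0)//; first by rewrite ltW// !mulr_gt0.
  nra.
have w0 : 0 < (2 * pi * xi) ^+ 2 by rewrite exprn_gt0// !mulr_gt0.
rewrite ler_pdivrMr ?exprn_gt0// mulrAC ler_pdivlMr//.
apply: ler_pM => //; first exact: ltW.
by rewrite ler_peMr// lerBrDr gerDl.
Qed.

Lemma fejer_mass_gt0 : 0 < \int[mu]_x fejer x.
Proof.
have c0 : 0 < 2 / pi ^+ 2 :> R by rewrite divr_gt0// exprn_gt0// pi_gt0.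
have iI := integrable_indic_itv (4^-1 : R) (2^-1) true false.
have e : \int[mu]_x (2 / pi ^+ 2 * \1_`[4^-1, 2^-1] x) = 2 / pi ^+ 2 * (2^-1 - 4^-1).
  rewrite RintegralZl//; congr (_ * _).
  rewrite /Rintegral integral_indic//= setIT lebesgue_measure_itv/= lte_fin.
  by rewrite ltf_pV2 ?posrE// ltr_nat.
apply: (@lt_le_trans _ _ (2 / pi ^+ 2 * (2^-1 - 4^-1))).
  by rewrite mulr_gt0// subr_gt0 ltf_pV2 ?posrE// ltr_nat.
rewrite -e; apply: le_Rintegral => //.
- exact: (integrableZl measurableT (2 / pi ^+ 2) iI).
- exact: integrable_fejer.
- move=> x _; rewrite indicE.
  have [xa|xa] := boolP (_ \in _); last by rewrite mulr0 fejer_ge0.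
  by rewrite mulr1 fejer_ge//; move: xa; rewrite inE/= in_itv/=.
Qed.

(** Monotone convergence along the windows [[-n, n]]. *)
Lemma fejer_mass_trunc (e : R) : 0 < e -> exists M : R, 0 < M /\
  \int[mu]_x (fejer x) - e <= \int[mu]_x (fejer x * \1_`[- M, M] x).
Proof.
move=> e0.
pose F (n : nat) (x : measurableTypeR R) := (fejer x * \1_`[- n%:R, n%:R] x)%:E.
have F1 n x : (0 <= F n x <= (fejer x)%:E)%E.
  have i1 : (\1_`[- n%:R, n%:R] x : R) <= 1 by rewrite indicE lern1 leq_b1.
  rewrite /F !lee_fin; apply/andP; split; first by rewrite mulr_ge0 ?fejer_ge0.
  by rewrite ler_piMr ?fejer_ge0.
have mF n : measurable_fun setT (F n).
  apply/measurable_EFinP/measurable_funM; first exact: measurable_fejer.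
  by apply: measurable_indic; exact: measurable_itv.
have cF x : F ^~ x @ \oo --> (fejer x)%:E.
  apply: cvg_near_cst; exists (Num.bound `|x|) => // n /= xn.
  rewrite /F indicE mem_set ?mulr1//= in_itv/= -ler_norml.
  have hb : (Num.bound `|x|)%:R <= n%:R :> R by rewrite ler_nat.
  by rewrite (le_trans _ hb)// ltW// archi_boundP.
have ndF x : {homo F ^~ x : n k / (n <= k)%N >-> (n <= k)%E}.
  move=> n k nk; rewrite lee_fin ler_wpM2l ?fejer_ge0//.
  rewrite !indicE ler_nat; have [xa|//] := boolP (x \in `[- n%:R, n%:R]%classic).
  rewrite mem_set//=; move: xa; rewrite inE/= !in_itv/= -!ler_norml.
  by move/le_trans; apply; rewrite ler_nat.
have := @cvg_monotone_convergence _ _ _ mu setT measurableT F mF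
  (fun n x _ => (andP (F1 n x)).1) (fun x _ => ndF x).
have -> : (fun x => limn (F ^~ x)) = (fun x => (fejer x)%:E).
  by apply/funext => x; apply/cvg_lim => //; exact: cF.
have fI : (\int[mu]_x (fejer x)%:E)%E = (\int[mu]_x fejer x)%:E.
  by rewrite /Rintegral fineK//; exact: integrable_fin_num integrable_fejer.
rewrite fI => cI.
have : \forall n \near \oo, (((\int[mu]_x fejer x) - e)%:E < \int[mu]_x F n x)%E.
  apply: (cI [set y | ((\int[mu]_x fejer x) - e)%:E < y]%E).
  by apply: open_ereal_gt'; rewrite lte_fin gtrBl.
(* The successor is taken so that the half-width of the window is positive even when [N] is 0. *)
case=> N _ /(_ N.+1 (leqnSn N)) h; exists N.+1%:R; split => //.
have iN : mu.-integrable setT (F N.+1).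
  apply: le_integrable integrable_fejer => // x _.
  have /andP[a b] := F1 N.+1 x.
  by rewrite gee0_abs// (le_trans b)//= lee_fin ler_norm.
rewrite -lee_fin /Rintegral fineK; last exact: integrable_fin_num iN.
exact: ltW h.
Qed.

End fejer.

(** * The Dirichlet kernel *)

Section torus.
Local Open Scope complex_scope.
Context {R : realType}.
Implicit Types (y : R) (k : int) (K : nat).

Lemma cintegrable_e2pi (a b w : R) :
  cintegrable (lebesgue_itv a b) (fun y : measurableTypeR R => e2pi (y * w)).
Proof.
have [mc ms] : cmeasurable (fun y : measurableTypeR R => e2pi (y * w)).
  by apply: cmeasurable_e2pi; exact: measurable_funM.
split; apply: (@integrable_bounded_itv _ a b 1) => // x.
- by have [] := e2pi_bounded (x * w).
- by have [] := e2pi_bounded (x * w).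
Qed.

Lemma cintegral_e2pi k :
  cintegral (lebesgue_itv 0 1) (fun y : measurableTypeR R => e2pi (y * k%:~R)) = (k == 0)%:R.
Proof.
have p0 : (pi : R) != 0 by rewrite gt_eqF// pi_gt0.
have [mc ms] : cmeasurable (fun y : measurableTypeR R => e2pi (y * k%:~R)).
  by apply: cmeasurable_e2pi; exact: measurable_funM.
pose w : R := 2 * pi * k%:~R.
have eR y : complex.Re (e2pi (y * k%:~R)) = cos (w * y).
  by rewrite /e2pi/= /w; congr cos; ring.
have eI y : complex.Im (e2pi (y * k%:~R)) = sin (w * y).
  by rewrite /e2pi/= /w; congr sin; ring.
have -> : cintegral (lebesgue_itv 0 1) (fun y : measurableTypeR R => e2pi (y * k%:~R)) =
    (\int[lebesgue_measure]_(y in `[0, 1]) cos (w * y)) +i*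
    (\int[lebesgue_measure]_(y in `[0, 1]) sin (w * y)).
  rewrite /cintegral !Rintegral_lebesgue_itv//.
  by congr Complex; apply: eq_Rintegral => y _; rewrite ?eR ?eI.
case: eqVneq => [k0|k0].
  have w0 : w = 0 by rewrite /w k0 mulr0.
  rewrite w0; congr Complex.
    under eq_Rintegral do rewrite mul0r cos0.
    rewrite Rintegral_cst//= lebesgue_measure_itv/= lte_fin ltr01/= mul1r.
    by rewrite subr0.
  under eq_Rintegral do rewrite mul0r sin0.
  by rewrite Rintegral_cst//= mul0r.
have w0 : w != 0 by rewrite !mulf_neq0 // intr_eq0.
have [sk ck] : sin w = 0 /\ cos w = 1.
  have := @e2pi_int R k; rewrite /e2pi -/w => /eqP; rewrite eq_complex /= => /andP[/eqP -> /eqP ->].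
  by [].
have dc (x : R) : is_derive x 1 (fun y => w^-1 * sin (w * y)) (cos (w * x)).
  apply: (is_derive_eq (is_derive1Z w^-1 (is_derive_sin_scale w x))).
  by rewrite mulKf.
have ds (x : R) : is_derive x 1 (fun y => - w^-1 * cos (w * y)) (sin (w * x)).
  apply: (is_derive_eq (is_derive1Z (- w^-1) (is_derive_cos_scale w x))).
  by rewrite mulrNN mulKf.
rewrite (Rintegral_FTC ltr01 (continuous_cos_scale (w := w)) dc).
rewrite (Rintegral_FTC ltr01 (continuous_sin_scale (w := w)) ds).
by rewrite mulr1 mulr0 sin0 cos0 sk ck !subrr.
Qed.

(** One-sided, with [K.+1] frequencies, so that [K = 0] gives the constant 1. *)
Definition dirichlet K y : R[i] := \sum_(l < K.+1) e2pi (y * l%:R).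

Lemma dirichletD K y k : dirichlet K (y + k%:~R) = dirichlet K y.
Proof.
apply: eq_bigr => l _; rewrite mulrDl e2piD.
have -> : k%:~R * l%:R = (k * l%:Z)%:~R :> R by rewrite intrM.
by rewrite e2pi_int mulr1.
Qed.

Let dirichletM K k y : dirichlet K y * e2pi (- (y * k%:~R)) =
  \sum_(l < K.+1) e2pi (y * (l%:Z - k)%:~R).
Proof.
rewrite mulr_suml; apply: eq_bigr => l _.
by rewrite -e2piD intrB mulrBr.
Qed.

Lemma cintegrable_dirichletM K k : cintegrable (lebesgue_itv 0 1)
  (fun y : measurableTypeR R => dirichlet K y * e2pi (- (y * k%:~R))).
Proof.
under eq_fun do rewrite dirichletM.
by apply: cintegrable_sum => l; exact: cintegrable_e2pi.
Qed.

Lemma fourier_dirichlet K k : cintegral (lebesgue_itv 0 1)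
  (fun y : measurableTypeR R => dirichlet K y * e2pi (- (y * k%:~R))) =
  ((0 <= k <= K%:Z)%R)%:R.
Proof.
under [X in cintegral _ X]eq_fun do rewrite dirichletM.
rewrite cintegral_sum; last by move=> l; exact: cintegrable_e2pi.
under eq_bigr do rewrite cintegral_e2pi subr_eq0.
case: k => [k|k].
  rewrite !lez_nat leq0n /=; case: leqP => kK.
    rewrite (bigD1 (Ordinal (kK : (k < K.+1)%N)))//= eqxx big1 ?addr0// => l lk.
    by rewrite eqz_nat; move: lk; rewrite -val_eqE /= => /negbTE ->.
  rewrite big1// => l _; rewrite eqz_nat.
  by case: eqVneq => // lk; move: kK; rewrite -lk ltnNge -ltnS ltn_ord.
by rewrite big1.
Qed.

Lemma cintegrable_dirichlet K : cintegrable (lebesgue_itv 0 1)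
  (dirichlet K : measurableTypeR R -> R[i]).
Proof.
by apply: cintegrable_sum => l; exact: cintegrable_e2pi.
Qed.

Lemma normc_sqr (z : R[i]) : (normc z ^+ 2)%:C = z * z^*.
Proof.
case: z => a b; rewrite /= sqr_sqrtr ?addr_ge0 ?sqr_ge0//.
rewrite complexME; congr Complex; ring.
Qed.

(** Parseval for a finite sum: expanding the conjugate factor leaves the Fourier coefficients at 0,
    .., K, each equal to 1. *)
Lemma dirichlet_sqr K :
  (lebesgue_itv 0 1).-integrable setT
    (fun y : measurableTypeR R => (normc (dirichlet K y) ^+ 2)%:E) /\
  \int[lebesgue_itv 0 1]_y (normc (dirichlet K y) ^+ 2) = K.+1%:R.
Proof.
have dE y : (normc (dirichlet K y) ^+ 2)%:C =
    \sum_(l < K.+1) dirichlet K y * e2pi (- (y * (l%:Z)%:~R)).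
  rewrite normc_sqr -mulr_sumr; congr (_ * _).
  by rewrite rmorph_sum; apply: eq_bigr => l _; rewrite e2piN.
have iD : cintegrable (lebesgue_itv 0 1) (fun y : measurableTypeR R => (normc (dirichlet K y) ^+ 2)%:C).
  under eq_fun do rewrite dE.
  by apply: cintegrable_sum => l; exact: cintegrable_dirichletM.
split; first exact: iD.1.
apply: complexI; rewrite -cintegral_real.
under [X in cintegral _ X]eq_fun do rewrite dE.
rewrite cintegral_sum; last by move=> l; exact: cintegrable_dirichletM.
under eq_bigr => l _ do rewrite fourier_dirichlet lez_nat -ltnS ltn_ord /=.
by rewrite sumr_const card_ord rmorph_nat.
Qed.

End torus.

(** * The wave and its Fourier transform *)

Section waveguide_product.
Local Open Scope complex_scope.
Context {R : realType}.

Lemma wg_prod m n (f : 'I_m -> measurableTypeR R -> R[i])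
    (g : 'I_n -> measurableTypeR R -> R[i]) :
  (forall i, cintegrable lebesgue_measure (f i)) ->
  (forall j, cintegrable (lebesgue_itv 0 1) (g j)) ->
  cintegrable (lebesgue_wg m n) (fun z : waveguide R m n =>
    (\prod_i f i (tnth z.1 i)) * \prod_j g j (tnth z.2 j)) /\
  cintegral (lebesgue_wg m n) (fun z : waveguide R m n =>
    (\prod_i f i (tnth z.1 i)) * \prod_j g j (tnth z.2 j)) =
  (\prod_i cintegral lebesgue_measure (f i)) *
    \prod_j cintegral (lebesgue_itv 0 1) (g j).
Proof.
move=> intf intg.
have [fi fE] := tuple_prod (mu := lebesgue_measure) intf.
have [gi gE] := tuple_prod (mu := lebesgue_itv 0 1) intg.
split; first exact: (cintegrable_prod fi gi).
by rewrite -fE -gE; exact: (cintegral_prod fi gi).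
Qed.

Lemma Rn_prod_real d (T : measurableType d) (mu : {sigma_finite_measure set T -> \bar R})
    m (f : T -> R) : mu.-integrable setT (EFin \o f) ->
  (tuple_measure mu m).-integrable setT (fun x => (\prod_i f (tnth x i))%:E) /\
  \int[tuple_measure mu m]_x (\prod_i f (tnth x i)) = (\int[mu]_x f x) ^+ m.
Proof.
move=> intf; have [ci cE] := tuple_prod (n := m) (fun _ => cintegrable_real intf).
have pE (x : m.-tuple T) : \prod_i (f (tnth x i))%:C = (\prod_i f (tnth x i))%:C.
  by rewrite rmorph_prod.
move: cE; under [X in cintegral _ X]eq_fun do rewrite pE.
rewrite cintegral_real cintegral_real prodr_const card_ord -rmorphXn => /complexI cE.
by split=> //; case: ci => + _; under eq_fun do rewrite pE.
Qed.

Lemma wg_prod_real m n (f g : measurableTypeR R -> R) :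
  (@lebesgue_measure R).-integrable setT (EFin \o f) ->
  (lebesgue_itv 0 1).-integrable setT (EFin \o g) ->
  (lebesgue_wg m n).-integrable setT (fun z : waveguide R m n =>
    ((\prod_i f (tnth z.1 i)) * \prod_j g (tnth z.2 j))%:E) /\
  \int[lebesgue_wg m n]_z ((\prod_i f (tnth z.1 i)) * \prod_j g (tnth z.2 j)) =
  (\int[lebesgue_measure]_x f x) ^+ m * (\int[lebesgue_itv 0 1]_x g x) ^+ n.
Proof.
move=> intf intg.
have [fi fE] := Rn_prod_real (mu := lebesgue_measure) m intf.
have [gi gE] := Rn_prod_real (mu := lebesgue_itv 0 1) n intg.
split; first exact: (integrable_prod fi gi).
by rewrite -fE -gE; exact: (Rintegral_prod fi gi).
Qed.

End waveguide_product.

Section wave.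
Local Open Scope complex_scope.
Context {R : realType} {m n : nat}.
Implicit Types (z : waveguide R m n) (zeta : frequency R m n).
Local Notation mu := (lebesgue_wg m n).

Definition wave (a : R) K z : R[i] :=
  (\prod_i (tent a (tnth z.1 i))%:C) * \prod_j dirichlet K (tnth z.2 j).

Definition rwave_hat (a : R) K zeta : R :=
  (\prod_i (a * fejer (a * tnth zeta.1 i))) *
  \prod_j ((0 <= tnth zeta.2 j <= K%:Z)%R)%:R.

Definition wave_hat (a : R) K zeta : R[i] := (rwave_hat a K zeta)%:C.

Variables (a : R) (K : nat).
Hypothesis a0 : 0 < a.

Lemma cintegrable_wave : cintegrable mu (wave a K).
Proof.
apply: (wg_prod (f := fun _ x => (tent a x)%:C) (g := fun _ => dirichlet K) _ _).1.
  by move=> _; apply: cintegrable_real; exact: integrable_tent.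
by move=> _; exact: cintegrable_dirichlet.
Qed.

Lemma fourier_wave zeta : fourier (wave a K) zeta = wave_hat a K zeta.
Proof.
have [_ e] := wg_prod
  (f := fun (i : 'I_m) x => (tent a x)%:C * e2pi (- (x * tnth zeta.1 i)))
  (g := fun (j : 'I_n) y => dirichlet K y * e2pi (- (y * (tnth zeta.2 j)%:~R)))
  (fun i => tent_cintegrable _ a0) (fun j => cintegrable_dirichletM _ _).
rewrite /wave_hat /rwave_hat rmorphM !rmorph_prod /=.
transitivity ((\prod_(i < m) (a * fejer (a * tnth zeta.1 i))%:C) *
  \prod_(j < n) (((0 <= tnth zeta.2 j <= K%:Z)%R)%:R : R[i])).
  under [in RHS]eq_bigr do rewrite -fourier_tent//.
  under [X in _ = _ * X]eq_bigr do rewrite -fourier_dirichlet.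
  rewrite -e; congr cintegral; apply/funext => z.
  rewrite !big_split /= /wave mulrACA; congr (_ * _).
  rewrite -!e2pi_sum -e2piD /pairing /dot opprD -!sumrN; congr e2pi.
  by congr (_ + _); apply: eq_bigr => i _; rewrite // tnth_mktuple.
by congr (_ * _); apply: eq_bigr => j _; rewrite rmorph_nat.
Qed.

Lemma wave_periodic : wg_periodic (wave a K).
Proof.
move=> x y k; rewrite /wave /=; congr (_ * _); apply: eq_bigr => j _.
by rewrite tnth_mktuple dirichletD.
Qed.

Lemma normc_wave z : normc (wave a K z) =
  (\prod_i tent a (tnth z.1 i)) * \prod_j normc (dirichlet K (tnth z.2 j)).
Proof.
have np I (s : seq I) (F : I -> R[i]) :
    normc (\prod_(i <- s) F i) = \prod_(i <- s) normc (F i).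
  elim: s => [|i s ih]; first by rewrite !big_nil ComplexField.Normc.normc1.
  by rewrite !big_cons ComplexField.Normc.normcM ih.
rewrite /wave ComplexField.Normc.normcM !np; congr (_ * _); apply: eq_bigr => i _.
by rewrite /= expr0n addr0 sqrtr_sqr ger0_norm// tent_ge0.
Qed.

Lemma integrable_dirichlet_norm : (lebesgue_itv 0 1).-integrable setT
  (fun y : measurableTypeR R => (normc (dirichlet K y))%:E).
Proof.
have [i2 _] := @dirichlet_sqr R K.
have mn : measurable_fun setT (fun y : measurableTypeR R => normc (dirichlet K y)).
  have -> : (fun y : measurableTypeR R => normc (dirichlet K y)) =
      (fun y => Num.sqrt (normc (dirichlet K y) ^+ 2)).
    by apply/funext => y; rewrite sqrtr_sqr ger0_norm//; case: (dirichlet K y) => *; exact: sqrtr_ge0.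
  have ms : measurable_fun [set: R] (@Num.sqrt R).
    by apply: continuous_measurable_fun; exact: sqrt_continuous.
  apply: (measurableT_comp ms).
  by apply/measurable_EFinP; exact: measurable_int i2.
(* On a finite measure space, [t <= 1 + t^2] derives integrability from square integrability. *)
have i1 := finite_measure_integrable_cst (lebesgue_itv 0 1) (1 : R) measurableT.
apply: (le_integrable measurableT _ _ (integrableD measurableT i1 i2)) => //=.
  exact/measurable_EFinP.
move=> y _; rewrite lee_fin; set t := normc _.
have t0 : 0 <= t by rewrite /t; case: (dirichlet K y) => *; exact: sqrtr_ge0.
rewrite !ger0_norm ?addr_ge0 ?sqr_ge0//.
nra.
Qed.

Lemma wave_L1 : in_Lp 1 (wave a K).
Proof.
split; [exact: wave_periodic|exact: cintegrable_cmeasurable cintegrable_wave|].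
have [iw _] := wg_prod_real m n (integrable_tent a0) integrable_dirichlet_norm.
rewrite /cLnorm Lnorm1; case/integrableP : iw => _.
apply: le_lt_trans; rewrite le_eqVlt; apply/orP; left; apply/eqP.
by apply: eq_integral => z _; rewrite normc_wave.
Qed.

Lemma integrable_tent2 :
  (@lebesgue_measure R).-integrable setT (fun x => (tent a x ^+ 2)%:E).
Proof.
under eq_fun do rewrite expr2.
apply: integrable_tentM => //; first exact: measurable_tent.
by move=> x; rewrite ger0_norm ?tent_ge0// tent_le1.
Qed.

Lemma Rintegral_tent2 : 0 <= \int[lebesgue_measure]_x (tent a x ^+ 2) <= 2 * a.
Proof.
apply/andP; split; first by apply: Rintegral_ge0 => x _; exact: sqr_ge0.
have iI := integrable_indic_itv (- a) a true false.
have <- : \int[lebesgue_measure]_x (\1_`[- a, a] x) = 2 * a.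
  rewrite /Rintegral integral_indic//= setIT lebesgue_measure_itv/= lte_fin.
  by rewrite gtrN//= opprK mulr_natl mulr2n.
apply: le_Rintegral => //; first exact: integrable_tent2.
move=> x _; rewrite indicE.
have [xa|xa] := boolP (x \in `[- a, a]%classic).
  by rewrite expr_le1 ?tent_ge0 ?tent_le1.
rewrite tent_out ?expr0n//; rewrite leNgt; apply: contra xa.
by rewrite inE/= in_itv/= ltr_norml => /andP[/ltW -> /ltW ->].
Qed.

Let wave2 : (mu).-integrable setT (fun z => (normc (wave a K z) ^+ 2)%:E) /\
  \int[mu]_z (normc (wave a K z) ^+ 2) <= (2 * a) ^+ m * K.+1%:R ^+ n.
Proof.
have [i2 e2] := @dirichlet_sqr R K.
have [iw ew] := wg_prod_real m n integrable_tent2 i2.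
have E z : normc (wave a K z) ^+ 2 = (\prod_i tent a (tnth z.1 i) ^+ 2) *
    \prod_j normc (dirichlet K (tnth z.2 j)) ^+ 2.
  by rewrite normc_wave exprMn !prodrXl.
split; first by under eq_fun do rewrite E.
under eq_Rintegral do rewrite E.
rewrite ew e2; have /andP[t0 t1] := Rintegral_tent2.
by rewrite ler_wpM2r ?exprn_ge0// lerXn2r// nnegrE (le_trans t0).
Qed.

(** The squared norm factors: each Euclidean coordinate contributes at most [2 a], because the
    squared tent lies below the indicator of [[-a, a]], and each periodic one contributes exactly
    [K.+1]. *)
Lemma cLnorm2_wave : (cLnorm mu 2 (wave a K) <=
  ((2 * a) `^ (m%:R / 2) * K.+1%:R `^ (n%:R / 2))%:E)%E.
Proof.
have [iw lw] := wave2.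
have a20 : 0 <= 2 * a by rewrite mulr_ge0// ltW.
rewrite /cLnorm unlock.
under eq_integral => z _.
  rewrite abse_EFin ger0_norm; last by case: (wave a K z) => *; exact: sqrtr_ge0.
  rewrite poweR_EFin powR_mulrn; last by case: (wave a K z) => *; exact: sqrtr_ge0.
  over.
rewrite -(fineK (integrable_fin_num measurableT iw)) poweR_EFin lee_fin.
apply: (@le_trans _ _ (((2 * a) ^+ m * K.+1%:R ^+ n) `^ 2^-1)).
  apply: ge0_ler_powR => //; rewrite nnegrE.
    by apply: Rintegral_ge0 => z _; exact: sqr_ge0.
  by rewrite mulr_ge0 ?exprn_ge0.
rewrite powRM ?exprn_ge0//.
by rewrite -!powR_mulrn// -!powRrM.
Qed.

Lemma wave_L2 : in_Lp 2 (wave a K).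
Proof.
split; [exact: wave_periodic|exact: cintegrable_cmeasurable cintegrable_wave|].
exact: le_lt_trans cLnorm2_wave (ltry _).
Qed.

(** At frequency zero the transform equals [a ^+ m > 0], whereas it would vanish for a function that
    is zero almost everywhere. *)
Lemma wave_nonzero : nonzero_L2 (wave a K).
Proof.
split; first exact: wave_L2.
move=> w0; have [mR mI] := cintegrable_cmeasurable cintegrable_wave.
pose z0 : frequency R m n := ([tuple of nseq m 0], [tuple of nseq n 0]).
have : fourier (wave a K) z0 = 0.
  have p0 z : e2pi (- pairing z z0) = 1.
    rewrite /pairing /dot !big1 ?addr0 ?oppr0 ?e2pi0// => i _.
      by rewrite tnth_mktuple tnth_nseq mulr0.
    by rewrite tnth_nseq mulr0.
  rewrite /fourier; under [X in cintegral _ X]eq_fun do rewrite p0 mulr1.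
  have ae0 (f : R[i] -> R) : f 0 = 0 -> measurable_fun setT (fun z => f (wave a K z)) ->
      \int[mu]_z f (wave a K z) = 0.
    move=> f0 mf; rewrite /Rintegral (@ae_eq_integral _ _ _ mu setT (cst 0%E))//.
    - by rewrite integral0.
    - exact/measurable_EFinP.
    - by apply: filterS w0 => z -> _; rewrite f0.
  by rewrite /cintegral !ae0.
rewrite fourier_wave /wave_hat /rwave_hat => /complexI/eqP; apply/negP.
rewrite mulf_neq0//; apply/prodf_neq0 => i _.
  by rewrite tnth_nseq mulr0 /fejer eqxx mulr1 gt_eqF.
by rewrite tnth_nseq lexx /= oner_eq0.
Qed.

End wave.

(** * The frequency box {0, .., K}^n *)

Section box.
Local Open Scope complex_scope.
Context {n : nat} (K : nat).

Definition box_point (t : n.-tuple 'I_K.+1) : n.-tuple int :=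
  [tuple (tnth t j : nat)%:Z | j < n].

(** A duplicate-free list, so that sums over Z^n supported in the box become finite sums with
    [K.+1 ^ n] terms. *)
Definition box : seq (n.-tuple int) := [seq box_point t | t : n.-tuple 'I_K.+1].

Lemma box_point_inj : injective box_point.
Proof.
move=> s t st; apply: eq_from_tnth => j; apply: val_inj.
by have := congr1 (fun k : n.-tuple int => tnth k j) st; rewrite !tnth_mktuple => -[].
Qed.

Lemma box_uniq : uniq box.
Proof. by rewrite map_inj_uniq ?enum_uniq//; exact: box_point_inj. Qed.

Lemma mem_box k : (k \in box) = [forall j, 0 <= tnth k j <= K%:Z].
Proof.
apply/mapP/forallP => [[t _ ->] j|kK].
  by rewrite tnth_mktuple !lez_nat /= -ltnS ltn_ord.
exists [tuple inord `|tnth k j|%N | j < n]; rewrite ?mem_enum//.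
apply: eq_from_tnth => j; rewrite !tnth_mktuple.
have := kK j; case: (tnth k j) => // l; rewrite !lez_nat /= => lK.
by rewrite inordK.
Qed.

Lemma size_box : size box = (K.+1 ^ n)%N.
Proof. by rewrite size_map -cardE card_tuple card_ord. Qed.

Lemma prod_mem_box (R : comNzRingType) (k : n.-tuple int) :
  \prod_j ((0 <= tnth k j <= K%:Z)%R)%:R = (k \in box)%:R :> R.
Proof.
rewrite mem_box; case: forallP => [kK|/existsNP[j /negP/negbTE jK]].
  by rewrite big1// => j _; rewrite kK.
by rewrite (bigD1 j)//= jK mul0r.
Qed.

Lemma fsum_box (V : nmodType) (F : n.-tuple int -> V) :
  (forall k, k \notin box -> F k = 0) ->
  \sum_(k \in [set: n.-tuple int]) F k = \sum_(k <- box) F k.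
Proof.
move=> F0; rewrite (fsbig_seq _ _ box_uniq); apply/esym/fsbig_widen => //.
by move=> k [_ /= /negP kb]; exact: F0.
Qed.

Lemma esum_box (R : realType) (F : n.-tuple int -> \bar R) :
  (forall k, 0 <= F k)%E -> (forall k, k \notin box -> F k = 0%E) ->
  (\esum_(k in [set: n.-tuple int]) F k = \sum_(k <- box) F k)%E.
Proof.
move=> Fge0 F0; rewrite (esumID [set` box])//.
rewrite setTI setTI [X in (_ + X)%E]esum1 ?adde0; last first.
  by move=> k /= /negP kb; exact: F0.
rewrite esum_fset//; last exact: finite_seq.
by rewrite -fsbig_seq//; exact: box_uniq.
Qed.

End box.

(** * The transform of the wave in the L^2 sense *)

Section wave_L2_transform.
Local Open Scope complex_scope.
Context {R : realType} {m n : nat}.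
Variables (a : R) (K : nat).
Hypothesis a0 : 0 < a.

(** The transform of [tent a], normalised in L^1: its total mass, and its mass where [|a x| <= M],
    do not depend on [a]. This is the source of the uniformity in [a]. *)
Definition gauge (x : measurableTypeR R) : R := a * fejer (a * x).

Lemma gauge_ge0 x : 0 <= gauge x.
Proof. by rewrite mulr_ge0 ?fejer_ge0// ltW. Qed.

Lemma gauge_le x : gauge x <= a.
Proof. by rewrite ler_piMr ?fejer_le1// ltW. Qed.

Lemma measurable_gauge : measurable_fun setT gauge.
Proof.
apply: measurable_funM => //.
have ma : measurable_fun [set: measurableTypeR R] (fun x => a * x : measurableTypeR R).
  exact: measurable_funM.
exact: (measurableT_comp measurable_fejer ma).
Qed.

Lemma integral_gauge (f : measurableTypeR R -> R) : measurable_fun setT f ->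
  (forall x, 0 <= f x) ->
  (\int[lebesgue_measure]_x (gauge x * f (a * x))%:E =
   \int[lebesgue_measure]_x (fejer x * f x)%:E)%E.
Proof.
move=> mf f0; rewrite [RHS](ge0_integral_scale a0).
- rewrite -ge0_integralZl//.
  + by apply: eq_integral => x _; rewrite -EFinM mulrA.
  + have ma : measurable_fun [set: measurableTypeR R] (fun x => a * x : measurableTypeR R).
      exact: measurable_funM.
    apply/measurable_EFinP/measurable_funM.
      exact: (measurableT_comp measurable_fejer ma).
    exact: (measurableT_comp mf ma).
  + by move=> x _; rewrite lee_fin mulr_ge0 ?fejer_ge0.
  + by rewrite lee_fin ltW.
- by apply/measurable_EFinP/measurable_funM => //; exact: measurable_fejer.
- by move=> x; rewrite lee_fin mulr_ge0 ?fejer_ge0.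
Qed.

Lemma integrable_gauge : (@lebesgue_measure R).-integrable setT (EFin \o gauge).
Proof.
apply/integrableP; split; first by apply/measurable_EFinP; exact: measurable_gauge.
have -> : (\int[lebesgue_measure]_x `|(EFin \o gauge) x| =
    \int[lebesgue_measure]_x (fejer x)%:E)%E.
  have := integral_gauge (f := cst 1) (measurable_cst _) (fun _ => ler01).
  under [in X in _ = X -> _]eq_integral do rewrite /= mulr1.
  move=> <-; apply: eq_integral => x _.
  by rewrite /= mulr1 ger0_norm// gauge_ge0.
by apply: integrable_lty => //; exact: integrable_fejer.
Qed.

Lemma rwave_hatE (xi : Rn R m) (k : n.-tuple int) :
  rwave_hat a K (xi, k) = (\prod_i gauge (tnth xi i)) * (k \in box K)%:R.
Proof. by rewrite /rwave_hat prod_mem_box. Qed.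

Lemma measurable_gauge_prod : measurable_fun setT (fun xi : Rn R m => \prod_i gauge (tnth xi i)).
Proof.
have [ip _] := Rn_prod_real (mu := lebesgue_measure) m integrable_gauge.
by apply/measurable_EFinP; exact: measurable_int ip.
Qed.

Lemma wave_hat_freq_L2 : freq_L2 (@wave_hat R m n a K).
Proof.
split=> [k|].
  split; last exact: measurable_cst.
  under eq_fun do rewrite /= rwave_hatE.
  by apply: measurable_funM => //; exact: measurable_gauge_prod.
rewrite /freq_sqnorm2 (esum_box (K := K)).
- apply: lte_sum_pinfty => k _.
  (* Since [0 <= gauge <= a], the square is dominated by [a * gauge], which is integrable. *)
  have i2 : (@lebesgue_measure R).-integrable setT (fun x => (gauge x ^+ 2)%:E).
    apply: (le_integrable measurableT _ _ (integrableZl measurableT a integrable_gauge)).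
      by apply/measurable_EFinP/measurable_funX; exact: measurable_gauge.
    move=> x _ /=; have g0 := gauge_ge0 x.
    rewrite lee_fin !ger0_norm ?sqr_ge0//; last exact: mulr_ge0 (ltW a0) g0.
    by rewrite expr2 ler_wpM2r// gauge_le.
  have [ip _] := Rn_prod_real (mu := lebesgue_measure) m i2.
  apply: le_lt_trans (integrable_lty measurableT ip).
  apply: ge0_le_integral => //.
  + by move=> x _; rewrite lee_fin sqr_ge0.
  + apply/measurable_EFinP/measurable_funX.
    under eq_fun do rewrite /wave_hat rwave_hatE /= expr0n addr0 sqrtr_sqr.
    apply: measurableT_comp => //; apply: measurable_funM => //; exact: measurable_gauge_prod.
  + by apply: measurable_int ip.
  + move=> x _; rewrite lee_fin /wave_hat rwave_hatE /= expr0n addr0 sqrtr_sqr real_normK ?num_real//.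
    rewrite exprMn prodrXl ler_piMr ?sqr_ge0// expr_le1// lern1; by case: (_ \in _).
- by move=> k; apply: integral_ge0 => x _; rewrite lee_fin sqr_ge0.
- move=> k kb; rewrite integral0_eq// => x _.
  by rewrite /wave_hat rwave_hatE (negbTE kb) mulr0 /= expr0n addr0 sqrtr0 expr0n.
Qed.

(** The wave is in both L^1 and L^2, so the constant sequence is an admissible approximation and
    both limits are limits of 0. *)
Lemma wave_fourier_L2 : is_fourier_L2 (@wave R m n a K) (wave_hat a K).
Proof.
split; first exact: wave_hat_freq_L2.
exists (fun=> wave a K); split.
- by move=> _; split; [exact: wave_L1|exact: wave_L2].
- apply: cvg_near_cst; apply: nearW => _.
  rewrite /cLnorm; under eq_Lnorm do rewrite subrr ComplexField.Normc.normc0.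
  by rewrite Lnorm0// eqe pnatr_eq0.
- apply: cvg_near_cst; apply: nearW => _.
  rewrite /freq_sqnorm2 esum1// => k _; rewrite integral0_eq// => xi _.
  by rewrite fourier_wave// subrr ComplexField.Normc.normc0 expr0n.
Qed.

End wave_L2_transform.

(** * Lower bound for a space-time norm *)

Section Lp_lower_bound.
Local Open Scope complex_scope.
Context {R : realType}.

(** The integral of a nonnegative function is a supremum over the simple functions below it, hence
    monotone without measurability. The larger function will be a power of [|u|], the smaller one an
    explicit product of indicators. *)
Lemma ge0_le_integral_nonmeasurable d (T : measurableType d)
    (mu : {measure set T -> \bar R}) (f g : T -> \bar R) :
  (forall x, 0 <= f x)%E -> (forall x, f x <= g x)%E ->
  (\int[mu]_x f x <= \int[mu]_x g x)%E.
Proof.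
move=> f0 fg; have g0 x : (0 <= g x)%E by exact: le_trans (f0 x) (fg x).
rewrite !ge0_integralTE//; apply: le_ereal_sup => _ [h hf <-].
by exists h => // x; exact: le_trans (hf x) (fg x).
Qed.

Lemma measurable_itvR (i : interval R) : @measurable _ (measurableTypeR R) [set` i].
Proof. exact: measurable_itv. Qed.

Lemma measurable_itv_indic (i : interval R) :
  measurable_fun setT (\1_[set` i] : measurableTypeR R -> R).
Proof. by apply: measurable_indic; exact: measurable_itv. Qed.

(** For [tau <= 1] the half-open intervals are disjoint, so the sum is the indicator of their union;
    for [tau = 1] they tile [[0, J[]. *)
Definition pulses (J : nat) (tau : R) (t : measurableTypeR R) : R :=
  \sum_(j < J) \1_`[j%:R, j%:R + tau[ t.

Lemma pulses_le1 J tau t : tau <= 1 -> pulses J tau t <= 1.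
Proof.
move=> tau1; have [/existsP[j jt]|/existsPn nt] :=
    boolP [exists j : 'I_J, t \in `[j%:R, j%:R + tau[].
  rewrite /pulses (bigD1 j)//= big1 ?addr0 ?indicE ?lern1 ?leq_b1// => i ij.
  rewrite indicE memNset// => /= it.
  move: jt it; rewrite !in_itv/= => /andP[j1 j2] /andP[i1 i2].
  have ltSn (k l : nat) : k%:R <= t -> t < l%:R + tau -> (k <= l)%N.
    move=> kt tl; rewrite -ltnS -(ltr_nat R) (le_lt_trans kt)//.
    by rewrite (lt_le_trans tl)// -natr1 lerD2l.
  case/eqP: ij; apply: val_inj; apply/eqP; rewrite eqn_leq /=.
  by rewrite (ltSn i j) ?(ltSn j i).
rewrite /pulses big1// => j _; rewrite indicE memNset//=.
exact/negP/nt.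
Qed.

Lemma pulses_ge0 J tau t : 0 <= pulses J tau t.
Proof. by apply: sumr_ge0 => j _; rewrite indicE. Qed.

Lemma Rintegral_itv_indic (a b c d : R) (x y : bool) : a <= c -> c <= d -> d <= b ->
  \int[lebesgue_itv a b]_t (\1_[set` Interval (BSide x c) (BSide y d)] t) = d - c.
Proof.
move=> ac cd db.
rewrite (Rintegral_lebesgue_itv a b (measurable_itv_indic _)).
rewrite /Rintegral (integral_indic _ (measurable_itvR _) (measurable_itvR _)).
rewrite setIidl; last first.
  move=> t /=; rewrite !itv_boundlr => /andP[ct td]; apply/andP; split.
    by apply: le_trans ct; rewrite bnd_simp.
  by apply: le_trans td _; rewrite bnd_simp.
rewrite /= lebesgue_measure_itv/= lte_fin; case: ltP => //= dc.
by apply/eqP; rewrite eq_sym subr_eq0 eq_le dc cd.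
Qed.

Lemma Rintegral_pulses J tau T : 0 <= tau -> J%:R - 1 + tau <= T ->
  (lebesgue_itv 0 T).-integrable setT (EFin \o pulses J tau) /\
  \int[lebesgue_itv 0 T]_t pulses J tau t = J%:R * tau.
Proof.
move=> tau0 JT.
have ii (j : 'I_J) : (lebesgue_itv 0 T).-integrable setT
    (fun t => (\1_`[j%:R, j%:R + tau[ t)%:E).
  exact: integrable_indic (measurable_itvR _).
have [iR _] := cintegrable_sum (index_enum 'I_J) (fun j => cintegrable_real (ii j)).
have E : cintegral (lebesgue_itv 0 T) (fun t => \sum_(j < J) (\1_`[j%:R, j%:R + tau[ t)%:C) =
    (J%:R * tau)%:C.
  rewrite cintegral_sum; last by move=> j; exact: cintegrable_real (ii j).
  under eq_bigr => j _.
    rewrite cintegral_real Rintegral_itv_indic//.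
    - rewrite addrC addrA addNr add0r; over.
    - by rewrite lerDl.
    - apply: le_trans JT; rewrite lerD2r lerBrDr natr1 ler_nat; exact: ltn_ord.
  by rewrite sumr_const card_ord mulr_natl rmorphMn.
have pE t : \sum_(j < J) (\1_`[j%:R, j%:R + tau[ t)%:C = (pulses J tau t)%:C :> R[i].
  by rewrite rmorph_sum.
move: E iR; under eq_fun do rewrite pE; rewrite cintegral_real => /complexI E.
by under eq_fun do rewrite pE.
Qed.

(** [|u|^p] dominates [L^p] times a product of indicators in time, in each [x_i] and in each [y_j],
    whose integral factors. The condition [J - 1 + tau <= T] keeps the last pulse in [[0, T]], and
    [sigma <= 1] keeps the periodic box in the fundamental domain. *)
Lemma cLnorm_lower (T p L tau r sigma : R) (J m n : nat)
    (u : R -> waveguide R m n -> R[i]) :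
  0 < p -> 0 <= L -> 0 <= r -> 0 <= sigma <= 1 -> 0 <= tau <= 1 ->
  J%:R - 1 + tau <= T ->
  (forall (t : R) (z : waveguide R m n),
    (exists2 j : nat, (j < J)%N & j%:R <= t < j%:R + tau) ->
    (forall i, `|tnth z.1 i| <= r) -> (forall i, 0 <= tnth z.2 i <= sigma) ->
    L <= normc (u t z)) ->
  ((L * (J%:R * tau * ((2 * r) ^+ m * sigma ^+ n)) `^ p^-1)%:E <=
    cLnorm (lebesgue_itv_wg 0 T m n) p (fun tz => u tz.1 tz.2))%E.
Proof.
move=> p0 L0 r0 /andP[s0 s1] /andP[t0 t1] JT uL.
have nc0 (z : R[i]) : 0 <= normc z by case: z => *; exact: sqrtr_ge0.
have [iP eP] := Rintegral_pulses t0 JT.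
have ix := integrable_indic_itv (- r) r true false.
have iy : (lebesgue_itv 0 1).-integrable setT (EFin \o (\1_`[0, sigma] : measurableTypeR R -> R)).
  exact: integrable_indic (measurable_itvR _).
have [iw ew] := wg_prod_real m n ix iy.
have iall := integrable_prod iP iw.
have eall := Rintegral_prod iP iw.
have ex : \int[lebesgue_measure]_x \1_`[- r, r] x = 2 * r :> R.
  rewrite /Rintegral integral_indic//= setIT lebesgue_measure_itv/= lte_fin.
  case: ltP => [_ /=|]; first by rewrite opprK mulr_natl mulr2n.
  move=> h; have -> : r = 0 by lra.
  by rewrite mulr0.
rewrite eP ew ex Rintegral_itv_indic// subr0 in eall.
rewrite /cLnorm unlock.
under eq_integral => z _ do rewrite abse_EFin ger0_norm// poweR_EFin.
set W := J%:R * tau * _.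
have W0 : 0 <= W by rewrite /W !mulr_ge0 ?exprn_ge0// mulr_ge0.
have -> : L * W `^ p^-1 = (L `^ p * W) `^ p^-1.
  by rewrite powRM ?powR_ge0// -powRrM divff ?gt_eqF// powRr1.
rewrite -poweR_EFin; apply: gt0_ler_poweR.
- by rewrite invr_ge0 ltW.
- by rewrite in_itv/= lee_fin leey mulr_ge0 ?powR_ge0.
- by rewrite in_itv/= leey integral_ge0// => z _; rewrite lee_fin powR_ge0.
rewrite /W -eall EFinM /Rintegral fineK; last exact: integrable_fin_num iall.
rewrite -integralZl//.
apply: ge0_le_integral_nonmeasurable => -[t z] /=.
  rewrite -EFinM lee_fin mulr_ge0 ?powR_ge0// mulr_ge0 ?pulses_ge0//.
  by rewrite mulr_ge0// prodr_ge0// => i _; rewrite indicE.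
rewrite -EFinM lee_fin.
have [/existsP[j jt]|/existsPn nt] := boolP [exists j : 'I_J, t \in `[j%:R, j%:R + tau[]; last first.
  rewrite {1}/pulses big1 ?mul0r ?mulr0 ?powR_ge0// => j _; rewrite indicE memNset//=.
  exact/negP/nt.
have [/forallP xr|/forallPn[i xr]] := boolP [forall i, `|tnth z.1 i| <= r]; last first.
  rewrite [in X in _ * (_ * (X * _))](bigD1 i)//= indicE memNset ?mul0r ?mulr0 ?powR_ge0//=.
  by apply/negP; rewrite in_itv/= -ler_norml.
have [/forallP ys|/forallPn[i ys]] := boolP [forall i, 0 <= tnth z.2 i <= sigma]; last first.
  rewrite [in X in _ * (_ * (_ * X))](bigD1 i)//= indicE memNset ?mul0r ?mulr0 ?powR_ge0//=.
  by apply/negP; rewrite in_itv/=.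
have px : \prod_(i < m) (\1_`[- r, r] (tnth z.1 i) : R) = 1.
  by rewrite big1// => i _; rewrite indicE mem_set//= in_itv/= -ler_norml.
have py : \prod_(i < n) (\1_`[0, sigma] (tnth z.2 i) : R) = 1.
  by rewrite big1// => i _; rewrite indicE mem_set//= in_itv/= ys.
rewrite px py !mulr1; apply: (@le_trans _ _ (L `^ p)).
  by rewrite ler_piMr ?powR_ge0// pulses_le1.
rewrite ge0_ler_powR ?nnegrE ?(ltW p0)//; apply: uL => //.
by exists j => //; move: jt; rewrite in_itv.
Qed.

End Lp_lower_bound.

(** * Lower bound for the wave *)

Section oscillation.
Local Open Scope complex_scope.
Context {R : realType}.
Local Notation mass := (\int[@lebesgue_measure R]_x fejer x).
Local Notation mass_in M :=
  (\int[@lebesgue_measure R]_x (fejer x * \1_`[- M, M] x)).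

(* [fejer <= 1] is the inequality [1 - cos w <= w^2 / 2]. *)
Lemma cos_ge_half (theta : R) : `|theta| <= (2 * pi)^-1 -> 2^-1 <= cos (2 * pi * theta).
Proof.
have p0 : 0 < 2 * pi :> R by rewrite mulr_gt0// pi_gt0.
move=> ht; have [->|t0] := eqVneq theta 0.
  by rewrite mulr0 cos0 invf_le1// ler1n.
have := fejer_le1 theta; rewrite /fejer (negbTE t0).
have w0 : 0 < (2 * pi * theta) ^+ 2.
  by rewrite exprn_even_gt0//= !mulf_neq0// gt_eqF// pi_gt0.
rewrite ler_pdivrMr// mul1r => h.
have w1 : (2 * pi * theta) ^+ 2 <= 1.
  rewrite -real_normK ?num_real// expr_le1// normrM (gtr0_norm p0).
  by rewrite -ler_pdivlMl// mulr1.
lra.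
Qed.

Lemma bernoulli_le (x : R) m : 0 <= x <= 1 -> 1 - m%:R * x <= (1 - x) ^+ m.
Proof.
move=> /andP[x0 x1]; elim: m => [|m ih]; first by rewrite mul0r subr0 expr0.
rewrite exprS; apply: (@le_trans _ _ ((1 - x) * (1 - m%:R * x))); last first.
  by rewrite ler_wpM2l// subr_ge0.
have m0 : 0 <= m%:R :> R by [].
rewrite -natr1; have : 0 <= m%:R * x * x by rewrite !mulr_ge0.
lra.
Qed.

(** The positive quantity is half the mass of the cube [[-M, M]^m] minus the mass of its complement,
    for the product kernel on R^m. *)
Lemma fejer_mass_ratio m : exists2 M : R, 0 < M &
  0 < 3 / 2 * mass_in M ^+ m - mass ^+ m.
Proof.
have I0 := @fejer_mass_gt0 R.
(* Each coordinate loses a fraction [eta] of its mass; by Bernoulli the cube keeps at least 1 - m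
   eta >= 5/6 of it, and 3/2 * 5/6 > 1. *)
pose eta : R := (6 * m.+1%:R)^-1.
have eta0 : 0 < eta by rewrite invr_gt0 mulr_gt0.
have eta1 : eta <= 1 by rewrite invf_le1 ?mulr_gt0// mulr_ege1 ?ler1n.
have [M [M0 hM]] := fejer_mass_trunc (mulr_gt0 I0 eta0).
exists M => //.
have h1 : mass * (1 - eta) <= mass_in M by rewrite mulrBr mulr1.
have h2 : (mass * (1 - eta)) ^+ m <= mass_in M ^+ m.
  have A0 : 0 <= mass * (1 - eta) by rewrite mulr_ge0 ?subr_ge0 ?(ltW I0).
  by rewrite lerXn2r// nnegrE (le_trans A0).
have h3 : 5 / 6 <= (1 - eta) ^+ m.
  apply: le_trans (bernoulli_le m _); last by rewrite eta1 ltW.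
  have : m%:R * eta <= 6^-1.
    rewrite /eta invfM mulrCA ler_piMr// ler_pdivrMr// mul1r ler_nat.
    exact: leqnSn.
  lra.
have Im0 : 0 < mass ^+ m by rewrite exprn_gt0.
rewrite exprMn in h2.
have h4 : mass ^+ m * (5 / 6) <= mass ^+ m * (1 - eta) ^+ m by rewrite ler_wpM2l// ltW.
lra.
Qed.

Lemma complex_Re_sum (I : Type) (s : seq I) (F : I -> R[i]) :
  complex.Re (\sum_(i <- s) F i) = \sum_(i <- s) complex.Re (F i).
Proof.
elim: s => [|i s ih]; first by rewrite !big_nil.
by rewrite !big_cons complex_ReD ih.
Qed.

Lemma Re_le_normc (z : R[i]) : complex.Re z <= normc z.
Proof.
case: z => x y /=; rewrite (le_trans (ler_norm _))// -sqrtr_sqr.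
by rewrite ler_wsqrtr// lerDl sqr_ge0.
Qed.

Lemma dot_bound l (x y : Rn R l) (r b : R) : 0 <= r ->
  (forall i, `|tnth x i| <= r) -> (forall i, `|tnth y i| <= b) ->
  `|dot x y| <= l%:R * (r * b).
Proof.
move=> r0 hx hy; rewrite (le_trans (ler_norm_sum _ _ _))//.
apply: (@le_trans _ _ (\sum_(i < l) r * b)).
  by apply: ler_sum => i _; rewrite normrM ler_pM.
by rewrite sumr_const card_ord mulr_natl.
Qed.

Lemma measurable_dot l (y : Rn R l) : measurable_fun setT (fun x : Rn R l => dot y x).
Proof.
apply: measurable_sum => i; apply: measurable_funM => //.
exact: measurable_tnth.
Qed.

Lemma measurable_dot_sqr l : measurable_fun setT (fun x : Rn R l => dot x x).
Proof.
by apply: measurable_sum => i; apply: measurable_funM; exact: measurable_tnth.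
Qed.

Lemma measurable_cutoff (eta : R -> R) : lp_cutoff eta -> measurable_fun setT eta.
Proof.
move=> [deta _ _ _]; apply: continuous_measurable_fun => x.
apply/differentiable_continuous/derivable1_diffP; exact: (deta 0%N x).
Qed.

Section slice.
Variables (m n : nat) (a M N t : R) (K : nat) (eta : R -> R).
Variables (z : waveguide R m n) (k : n.-tuple int).
Hypotheses (a0 : 0 < a) (N0 : 0 < N) (etaP : lp_cutoff eta).
Hypothesis kK : k \in box K.

Let integrand (xi : Rn R m) : R[i] := schrodinger_multiplier t (xi, k) *
  (lp_multiplier eta N (xi, k) * wave_hat a K (xi, k)) * e2pi (pairing z (xi, k)).

Let phase (xi : Rn R m) : R := pairing z (xi, k) - t * sqnorm (xi, k).

Let cut (xi : Rn R m) : R := eta (Num.sqrt (sqnorm (xi, k)) / N).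

Let g (xi : Rn R m) : R := \prod_i gauge a (tnth xi i).

Let integrandE xi : integrand xi = (g xi)%:C * ((cut xi)%:C * e2pi (phase xi)).
Proof.
rewrite /integrand /wave_hat rwave_hatE kK mulr1 /phase e2piD.
rewrite /schrodinger_multiplier /lp_multiplier -/(g xi) -/(cut xi).
move: (cut xi)%:C (g xi)%:C (e2pi (- _)) (e2pi (pairing _ _)) => p q v w.
ring.
Qed.

Let cut01 xi : 0 <= cut xi <= 1.
Proof. by case: etaP => _ h _ _; exact: h. Qed.

Let g0 xi : 0 <= g xi.
Proof. by apply: prodr_ge0 => i _; exact: gauge_ge0. Qed.

Let ReE xi : complex.Re (integrand xi) = g xi * (cut xi * cos (2 * pi * phase xi)).
Proof. by rewrite integrandE !complex_ReM /= !mul0r !subr0. Qed.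

Let mass_in_prod :
  (lebesgue_Rn m).-integrable setT (fun xi : Rn R m =>
     (\prod_i (gauge a (tnth xi i) * \1_`[- M, M] (a * tnth xi i)))%:E) /\
  \int[lebesgue_Rn m]_xi
     \prod_i (gauge a (tnth xi i) * \1_`[- M, M] (a * tnth xi i)) = mass_in M ^+ m.
Proof.
have ma : measurable_fun [set: measurableTypeR R] (fun x => a * x : measurableTypeR R).
  exact: measurable_funM.
have m1 := @measurable_itv_indic R `[- M, M].
have i1 : (@lebesgue_measure R).-integrable setT
    (EFin \o (fun x => gauge a x * \1_`[- M, M] (a * x))).
  apply: (le_integrable measurableT _ _ (integrable_gauge a0)).
    apply/measurable_EFinP/measurable_funM; first exact: measurable_gauge.
    exact: (measurableT_comp m1 ma).
  move=> x _; rewrite lee_fin normrM ler_piMr// ger0_norm indicE//.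
  by rewrite lern1 leq_b1.
have [ip ep] := Rn_prod_real (mu := lebesgue_measure) m i1.
split => //; rewrite /lebesgue_Rn ep; congr (_ ^+ _).
rewrite /Rintegral integral_gauge// => x; by rewrite indicE.
Qed.

Let mass_prod : (lebesgue_Rn m).-integrable setT (EFin \o g) /\
  \int[lebesgue_Rn m]_xi g xi = mass ^+ m.
Proof.
have [ip ep] := Rn_prod_real (mu := lebesgue_measure) m (integrable_gauge a0).
split => //; rewrite /lebesgue_Rn ep; congr (_ ^+ _).
rewrite /Rintegral; congr fine.
transitivity (\int[lebesgue_measure]_x (gauge a x * cst 1 (a * x))%:E)%E.
  by apply: eq_integral => x _; rewrite mulr1.
rewrite integral_gauge//; by apply: eq_integral => x _; rewrite mulr1.
Qed.

Let integrand_cintegrable : cintegrable (lebesgue_Rn m) integrand.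
Proof.
rewrite (funext integrandE); apply: (cintegrableM_bounded (M := 1)).
- by apply: cintegrable_real; exact: mass_prod.1.
- have msq : measurable_fun setT (fun xi : Rn R m => sqnorm (xi, k)).
    have mc : measurable_fun [set: Rn R m] (fun=> dot (int_tuple k : Rn R n) (int_tuple k)).
      exact: measurable_cst.
    exact (measurable_funD (@measurable_dot_sqr m) mc).
  have mpair : measurable_fun setT (fun xi : Rn R m => pairing z (xi, k)).
    have mc : measurable_fun [set: Rn R m] (fun=> dot z.2 (int_tuple k)) by exact: measurable_cst.
    exact (measurable_funD (@measurable_dot m z.1) mc).
  have mp : measurable_fun setT phase.
    exact: (measurable_funB mpair (measurable_funM (measurable_cst t) msq)).
  have mc : measurable_fun setT cut.
    apply: (measurableT_comp (measurable_cutoff etaP)).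
    apply: measurable_funM => //.
    have ms : measurable_fun [set: R] (@Num.sqrt R).
      by apply: continuous_measurable_fun; exact: sqrt_continuous.
    exact: (measurableT_comp ms).
  have [mR mI] := cmeasurable_e2pi mp.
  split; under eq_fun do rewrite ?complex_ReM ?complex_ImM /= mul0r ?subr0 ?addr0;
  exact: measurable_funM.
- move=> xi; have /andP[c0 c1] := cut01 xi; have [h1 h2] := e2pi_bounded (phase xi).
  rewrite complex_ReM complex_ImM /= !mul0r subr0 addr0 !normrM (ger0_norm c0).
  by split; rewrite mulr_ile1.
Qed.

(** Pointwise comparison with [3/2 * g * 1_cube - g]. On the cube the cutoff is 1 and the cosine at
    least 1/2, so the real part is at least [g / 2]; off the cube [cut * cos >= -1] bounds it below
    by [- g]. *)
Lemma slice_lower :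
  (forall xi : Rn R m, (forall i, `|a * tnth xi i| <= M) ->
    sqnorm (xi, k) <= N ^+ 2 /\ 2^-1 <= cos (2 * pi * phase xi)) ->
  3 / 2 * mass_in M ^+ m - mass ^+ m <=
    complex.Re (cintegral (lebesgue_Rn m) integrand).
Proof.
move=> hB; have [iM eM] := mass_in_prod; have [ig eg] := mass_prod.
rewrite -eM -eg -RintegralZl// -RintegralB//; last exact: (integrableZl measurableT (3 / 2) iM).
rewrite [leRHS](_ : _ = \int[lebesgue_Rn m]_xi (g xi * (cut xi * cos (2 * pi * phase xi)))); last first.
  by apply: eq_Rintegral => xi _; exact: ReE.
apply: le_Rintegral => //.
- exact (integrableB measurableT (integrableZl measurableT (3 / 2) iM) ig).
- by apply: eq_integrable integrand_cintegrable.1 => // xi _; congr EFin; exact: ReE.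
move=> xi _; have /andP[c0 c1] := cut01 xi; have gx := g0 xi.
have [/forallP xB|/forallPn[i xB]] := boolP [forall i, `|a * tnth xi i| <= M].
  have [sN hc] := hB xi xB.
  have -> : \prod_i (gauge a (tnth xi i) * \1_`[- M, M] (a * tnth xi i)) = g xi.
    by apply: eq_bigr => i _; rewrite indicE mem_set ?mulr1//= in_itv/= -ler_norml.
  have -> : cut xi = 1.
    case: etaP => _ _ + _; apply; rewrite ger0_norm ?divr_ge0 ?sqrtr_ge0 ?(ltW N0)//.
    by rewrite ler_pdivrMr// mul1r -(ger0_norm (ltW N0)) -sqrtr_sqr ler_wsqrtr.
  rewrite mul1r; nra.
rewrite (bigD1 i)//= indicE memNset ?mulr0 ?mul0r ?mulr0 ?sub0r; last first.
  by apply/negP; rewrite /= in_itv/= -ler_norml.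
have hc := cos_geN1 (2 * pi * phase xi).
rewrite -mulrN1 ler_wpM2l//.
nra.
Qed.

End slice.

End oscillation.

(** * Comparison of real powers *)

Section powers.
Context {R : realType}.

Lemma powRDr (x y z : R) : 0 < x -> x `^ (y + z) = x `^ y * x `^ z.
Proof. by move=> x0; rewrite powRD//; apply/implyP => _; rewrite gt_eqF. Qed.

Lemma powRVr (x y : R) : 0 < x -> x^-1 `^ y = x `^ (- y).
Proof. by move=> x0; rewrite -powR_inv1 ?ltW// -powRrM mulN1r. Qed.

(** The exponent may have either sign: the lower bound on [k] is used when it is nonnegative, the
    upper bound when it is negative, and [|e|] covers both. *)
Lemma powR_quasi (l k N e : R) : 1 <= l -> 0 < N -> N / l <= k -> k <= l * N ->
  l `^ (- `|e|) * N `^ e <= k `^ e.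
Proof.
move=> l1 N0 Nk kN; have l0 : 0 < l by rewrite (lt_le_trans _ l1).
have k0 : 0 < k by rewrite (lt_le_trans _ Nk)// divr_gt0.
have [e0|e0] := leP 0 e.
  rewrite ger0_norm// -powRVr// -powRM ?invr_ge0 ?(ltW l0) ?(ltW N0)//.
  rewrite ge0_ler_powR// ?nnegrE ?mulr_ge0 ?invr_ge0 ?(ltW l0) ?(ltW N0) ?(ltW k0)//.
  by rewrite mulrC.
rewrite ltr0_norm// opprK -powRM ?(ltW l0) ?(ltW N0)//.
have eV (x : R) : 0 < x -> x `^ e = x^-1 `^ (- e) by move=> x0; rewrite powRVr// opprK.
have ne0 : 0 <= - e by rewrite oppr_ge0 ltW.
have lN0 : 0 < l * N by rewrite mulr_gt0.
rewrite !eV//; apply: ge0_ler_powR => //; rewrite ?nnegrE ?invr_ge0 ?(ltW lN0) ?(ltW k0)//.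
by rewrite lef_pV2 ?posrE.
Qed.

End powers.

(** * The space-time estimate for a general wave *)

Section core.
Local Open Scope complex_scope.
Context {R : realType}.
Local Notation mass := (\int[@lebesgue_measure R]_x fejer x).
Local Notation mass_in M :=
  (\int[@lebesgue_measure R]_x (fejer x * \1_`[- M, M] x)).

Definition wave_flow m n (eta : R -> R) (N a : R) K (t : R) (z : waveguide R m n) : R[i] :=
  inv_fourier (fun zeta => schrodinger_multiplier t zeta *
    (lp_multiplier eta N zeta * wave_hat a K zeta)) z.

Lemma wave_flowE m n (eta : R -> R) (N a : R) K (t : R) (z : waveguide R m n) :
  wave_flow eta N a K t z = \sum_(k <- box K)
    cintegral (lebesgue_Rn m) (fun xi => schrodinger_multiplier t (xi, k) *
      (lp_multiplier eta N (xi, k) * wave_hat a K (xi, k)) * e2pi (pairing z (xi, k))).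
Proof.
apply: fsum_box => k kK.
under [X in cintegral _ X]eq_fun do
  rewrite /wave_hat rwave_hatE (negbTE kK) mulr0 !mulr0 mul0r.
by rewrite (cintegral_real _ (cst 0)) /Rintegral integral0.
Qed.

(** Periodicity in time of the flow on the torus: with [q = |k|^2] an integer, only the offset of
    [t] from the integer [j] matters, because [j * q] is a whole number of turns. *)
Lemma cos_phase (theta t : R) (j : nat) (q : int) :
  cos (2 * pi * (theta - t * q%:~R)) = cos (2 * pi * (theta - (t - j%:R) * q%:~R)).
Proof.
have -> : theta - t * q%:~R = theta - (t - j%:R) * q%:~R + (- (j%:Z * q))%:~R.
  by rewrite mulrNz intrM; ring.
have := e2piD (theta - (t - j%:R) * q%:~R) (- (j%:Z * q))%:~R.
by rewrite e2pi_int mulr1 => /(congr1 (@complex.Re R)).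
Qed.

Lemma dot_int_tuple n (k : n.-tuple int) :
  dot (int_tuple k) (int_tuple k) = (\sum_j tnth k j * tnth k j)%:~R :> R.
Proof.
rewrite rmorph_sum; apply: eq_bigr => j _.
by rewrite !tnth_mktuple /= rmorphM.
Qed.

(** The four terms of the phase hypothesis bound x.xi, y.k, t |xi|^2 and (t - j) |k|^2. All real
    parts are then bounded below by the same positive or negative number, and the [K.+1 ^ n]
    frequencies add up. The time facing |xi|^2 is bounded by [J - 1 + tau], which is just [tau] for
    a single pulse. *)
Lemma wave_flow_lower m n (eta : R -> R) (N a M r sigma tau : R) (J K j : nat)
    (t : R) (z : waveguide R m n) :
  0 < a -> 0 < N -> 0 <= M -> 0 <= r -> lp_cutoff eta ->
  m%:R * (M / a * (M / a)) + n%:R * (K%:R * K%:R) <= N ^+ 2 ->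
  m%:R * (r * (M / a)) + n%:R * (sigma * K%:R) +
    (J%:R - 1 + tau) * (m%:R * (M / a * (M / a))) +
    tau * (n%:R * (K%:R * K%:R)) <= (2 * pi)^-1 ->
  (j < J)%N -> j%:R <= t < j%:R + tau ->
  (forall i, `|tnth z.1 i| <= r) -> (forall i, 0 <= tnth z.2 i <= sigma) ->
  K.+1%:R ^+ n * (3 / 2 * mass_in M ^+ m - mass ^+ m) <=
    normc (wave_flow eta N a K t z).
Proof.
move=> a0 N0 M0 r0 etaP HN Hphase jJ /andP[jt tj] zx zy.
apply: le_trans (Re_le_normc _); rewrite wave_flowE complex_Re_sum.
have -> : K.+1%:R ^+ n * (3 / 2 * mass_in M ^+ m - mass ^+ m) =
    \sum_(k <- @box n K) (3 / 2 * mass_in M ^+ m - mass ^+ m).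
  by rewrite big_const_seq count_predT size_box iter_addr_0 -[RHS]mulr_natl natrX.
rewrite big_seq [leRHS]big_seq; apply: ler_sum => k kK.
apply: (@slice_lower _ m n a M N t K eta z k) => // xi xB.
have Ma0 : 0 <= M / a by rewrite divr_ge0// ltW.
have xB' i : `|tnth xi i| <= M / a.
  by rewrite ler_pdivlMr// mulrC -(gtr0_norm a0) -normrM.
have kB (i : 'I_n) : `|tnth (int_tuple k : Rn R n) i| <= K%:R.
  rewrite tnth_mktuple; move: kK; rewrite mem_box => /forallP/(_ i)/andP[k0 k1].
  by rewrite ger0_norm ?ler0z// -[leRHS]/(K%:Z%:~R) ler_int.
have yB (i : 'I_n) : `|tnth z.2 i| <= sigma.
  by have /andP[y0 y1] := zy i; rewrite ger0_norm.
have dxx := dot_bound Ma0 xB' xB'.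
have dkk := dot_bound (ler0n R K) kB kB.
have dzx := dot_bound r0 zx xB'.
have dzk : `|dot z.2 (int_tuple k)| <= n%:R * (sigma * K%:R).
  (* The sign of [sigma] is read off a coordinate of [z.2]; for [n = 0] there is none, but the inner
     product is an empty sum. *)
  have [n0|n0] := posnP n.
    by rewrite /dot; subst n; rewrite big_ord0 normr0 mul0r.
  have s0 : 0 <= sigma by have /andP[y0 y1] := zy (Ordinal n0); exact: le_trans y1.
  exact: dot_bound.
have dxx0 : 0 <= dot xi xi by apply: sumr_ge0 => i _; rewrite -expr2 sqr_ge0.
have dkk0 : 0 <= dot (int_tuple k : Rn R n) (int_tuple k).
  by apply: sumr_ge0 => i _; rewrite -expr2 sqr_ge0.
rewrite ger0_norm// in dxx; rewrite ger0_norm// in dkk.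
split; first exact: le_trans (lerD dxx dkk) HN.
(* The two parts of |zeta|^2 are separated because only |k|^2 is an integer, so only its time can be
   reduced modulo 1. *)
have -> : pairing z (xi, k) - t * sqnorm (xi, k) =
    pairing z (xi, k) - t * dot xi xi - t * dot (int_tuple k : Rn R n) (int_tuple k).
  by rewrite /sqnorm /= mulrDr opprD addrA.
rewrite dot_int_tuple (cos_phase _ _ j) -dot_int_tuple.
apply: cos_ge_half; apply: le_trans Hphase.
rewrite /pairing /=.
have t0 : 0 <= t by apply: le_trans jt.
have tJ : t <= J%:R - 1 + tau.
  rewrite (le_trans (ltW tj))// lerD2r lerBrDr natr1 ler_nat//.
have s0 : 0 <= t - j%:R by rewrite subr_ge0.
have s1 : t - j%:R <= tau by rewrite lerBlDl ltW.
rewrite (le_trans (ler_normB _ _))//; apply: lerD; last first.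
  by rewrite normrM !ger0_norm// ler_pM.
rewrite (le_trans (ler_normB _ _))//; apply: lerD; last first.
  by rewrite normrM !ger0_norm// ler_pM.
by rewrite (le_trans (ler_normD _ _))// lerD.
Qed.

(** The height [K.+1 ^ n * lam], times the volume of the favourable set to the power [1 / p],
    divided by the bound on the L^2 norm. The constants are fixed before [eta], [T], [N] and the
    parameters of the wave, so they depend on [p], [m], [n] only. *)
Lemma wave_estimate (p : R) (m n : nat) : 0 < p -> (0 < m)%N -> (0 < n)%N ->
  exists C M delta : R, [/\ 0 < C, 0 < M, 0 < delta &
    forall (eta : R -> R) (T N a tau : R) (J K : nat), lp_cutoff eta ->
      0 < N -> 0 < a -> 0 <= tau <= 1 -> J%:R - 1 + tau <= T ->
      m%:R * (M / a * (M / a)) + n%:R * (K%:R * K%:R) <= N ^+ 2 ->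
      (J%:R - 1 + tau) * (m%:R * (M / a * (M / a))) <= delta ->
      tau * (n%:R * (K%:R * K%:R)) <= delta ->
    exists (phi : waveguide R m n -> R[i]) (u : R -> waveguide R m n -> R[i]),
      [/\ nonzero_L2 phi, is_schrodinger_lp eta N phi u &
        ((C * a `^ (m%:R / p - m%:R / 2) * K.+1%:R `^ (n%:R / 2 - n%:R / p)
            * (J%:R * tau) `^ p^-1)%:E * cLnorm (lebesgue_wg m n) 2 phi
         <= cLnorm (lebesgue_itv_wg 0 T m n) p (fun tz => u tz.1 tz.2))%E]].
Proof.
move=> p0 m0 n0; have [M M0 lam0] := @fejer_mass_ratio R m.
set lam := _ - _ in lam0.
have p2 : 1 < 2 * pi :> R by have := pi_ge2 R; lra.
(* A quarter of the admissible phase [(2 pi)^-1] for each of the four phase terms. *)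
pose delta : R := (2 * pi)^-1 / 4.
have d0 : 0 < delta by rewrite divr_gt0// invr_gt0 (lt_trans _ p2).
have d1 : delta <= 1.
  rewrite ler_pdivrMr// mul1r (@le_trans _ _ 1)//; last by rewrite ler1n.
  by rewrite invf_le1 ?(lt_trans _ p2)// ltW.
have mr0 : 0 < m%:R :> R by rewrite ltr0n.
have nr0 : 0 < n%:R :> R by rewrite ltr0n.
(* These give [2 * r = b * a] and [sigma = e / K.+1] below, the sizes for which x.xi and y.k are
   each at most [delta]. *)
pose b : R := 2 * (delta / (m%:R * M)).
pose e : R := delta / n%:R.
have b0 : 0 < b by rewrite mulr_gt0// divr_gt0// mulr_gt0.
have e0 : 0 < e by rewrite divr_gt0.
exists (lam * b `^ (m%:R / p) * e `^ (n%:R / p) / 2 `^ (m%:R / 2)), M, delta.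
split=> //; first by rewrite !mulr_gt0 ?invr_gt0 ?powR_gt0.
move=> eta T N a tau J K etaP N0 a0 /andP[tau0 tau1] JT HN H1 H2.
exists (wave a K), (wave_flow eta N a K); split; first exact: wave_nonzero.
  by exists (wave_hat a K) => //; exact: wave_fourier_L2.
have k0 : 0 < K.+1%:R :> R by rewrite ltr0n.
pose r := delta / (m%:R * M) * a; pose sigma := e / K.+1%:R.
have r0 : 0 < r by rewrite mulr_gt0// divr_gt0// mulr_gt0.
have s01 : 0 <= sigma <= 1.
  have e1 : e <= 1 by rewrite /e ler_pdivrMr// mul1r (le_trans d1)// ler1n.
  rewrite divr_ge0 ?(ltW e0)//= ler_pdivrMr// mul1r (le_trans e1)// ler1n//.
have phase_ok : m%:R * (r * (M / a)) + n%:R * (sigma * K%:R) +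
    (J%:R - 1 + tau) * (m%:R * (M / a * (M / a))) +
    tau * (n%:R * (K%:R * K%:R)) <= (2 * pi)^-1.
  have -> : m%:R * (r * (M / a)) = delta.
    by rewrite /r; field; rewrite !gt_eqF.
  have : n%:R * (sigma * K%:R) <= delta.
    (* Dividing by [K.+1] rather than [K] keeps [sigma] meaningful for [K = 0]. *)
    have -> : n%:R * (sigma * K%:R) = delta * (K%:R / K.+1%:R).
      by rewrite /sigma /e; field; rewrite nat1r !gt_eqF.
    by rewrite ler_piMr ?(ltW d0)// ler_pdivrMr// mul1r ler_nat.
  have -> : (2 * pi)^-1 = delta + delta + delta + delta.
    by rewrite /delta; move: ((2 * pi)^-1) => q; field.
  lra.
apply: le_trans (cLnorm_lower (L := K.+1%:R ^+ n * lam) (tau := tau) (r := r)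
  (sigma := sigma) (J := J) p0 _ _ _ _ JT _) => //; first last.
- move=> t z [j jJ jt] zx zy.
  exact: (@wave_flow_lower _ _ eta N a M r sigma tau J K j t z a0 N0 (ltW M0) (ltW r0)).
- by rewrite tau0.
- exact: ltW.
- by rewrite mulr_ge0 ?exprn_ge0// ltW.
rewrite (le_trans (lee_wpmul2l _ (@cLnorm2_wave _ m n a K a0)))//.
  by rewrite lee_fin !mulr_ge0 ?invr_ge0 ?powR_ge0 ?(ltW lam0).
rewrite -EFinM lee_fin le_eqVlt; apply/orP; left; apply/eqP.
have sg0 : 0 <= sigma by case/andP: s01.
have r20 : 0 <= 2 * r by rewrite mulr_ge0// ltW.
have ba0 : 0 <= b * a by rewrite mulr_ge0// ltW.
have Jt0 : 0 <= J%:R * tau by rewrite mulr_ge0.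
have W0 : 0 <= (2 * r) ^+ m * sigma ^+ n by apply: mulr_ge0; exact: exprn_ge0.
rewrite (powRM _ Jt0 W0).
have -> : ((2 * r) ^+ m * sigma ^+ n) `^ p^-1 =
    b `^ (m%:R / p) * a `^ (m%:R / p) * (e `^ (n%:R / p) * K.+1%:R `^ (- (n%:R / p))).
  have -> : 2 * r = b * a by rewrite /b /r mulrA.
  rewrite powRM ?exprn_ge0// -!powR_mulrn// -!powRrM.
  rewrite powRM ?(ltW b0) ?(ltW a0)// /sigma powRM ?invr_ge0 ?(ltW e0) ?(ltW k0)//.
  by rewrite powRVr.
rewrite (powRM _ (ler0n R 2) (ltW a0)) -powR_mulrn ?(ltW k0)//.
have -> : K.+1%:R `^ n%:R = K.+1%:R `^ (n%:R / 2) * K.+1%:R `^ (n%:R / 2) :> R.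
  by rewrite -powRDr//; congr powR; field.
rewrite !powRDr// (powRN a).
have a'0 : a `^ (m%:R / 2) != 0 by rewrite gt_eqF// powR_gt0.
have two0 : (2 : R) `^ (m%:R / 2) != 0 by rewrite gt_eqF// powR_gt0.
move: (a `^ (m%:R / 2)) (2 `^ (m%:R / 2)) a'0 two0.
move: (b `^ _) (e `^ _) (a `^ _) (_ `^ (n%:R / 2)) (_ `^ (- _)) (_ `^ p^-1).
by move=> c1 c2 c3 c4 c5 c6 c8 c9 h8 h9; field; rewrite h8 h9.
Qed.

End core.

(** * The choice of parameters for the three waves *)

Theorem theorem1p2 (R : realType) (p : R) (m n : nat)
    (hp : 2 <= p) (hm : (1 <= m)%N) (hn : (1 <= n)%N) :
  exists2 c : R, 0 < c &
    forall eta : R -> R, lp_cutoff eta ->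
    forall T N : R, 1 <= T -> (exists j : nat, N = 2 ^+ j) ->
    exists phi1 phi2 phi3 : waveguide R m n -> R[i],
    exists u1 u2 u3 : R -> waveguide R m n -> R[i],
    [/\ nonzero_L2 phi1 /\ nonzero_L2 phi2 /\ nonzero_L2 phi3,
        is_schrodinger_lp eta N phi1 u1 /\
        is_schrodinger_lp eta N phi2 u2 /\
        is_schrodinger_lp eta N phi3 u3,
        ((c * T `^ ((m%:R + 2) / (2 * p) - m%:R / 4))%:E
           * cLnorm (lebesgue_wg m n) 2 phi1
         <= cLnorm (lebesgue_itv_wg 0 T m n) p (fun tz => u1 tz.1 tz.2))%E,
        ((c * T `^ ((m%:R + 2) / (2 * p) - m%:R / 4)
            * N `^ (n%:R / 2 - (n%:R + 2) / p))%:E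
           * cLnorm (lebesgue_wg m n) 2 phi2
         <= cLnorm (lebesgue_itv_wg 0 T m n) p (fun tz => u2 tz.1 tz.2))%E
      & ((c * N `^ ((m + n)%:R / 2 - ((m + n)%:R + 2) / p))%:E
           * cLnorm (lebesgue_wg m n) 2 phi3
         <= cLnorm (lebesgue_itv_wg 0 T m n) p (fun tz => u3 tz.1 tz.2))%E].
Proof.
have p0 : 0 < p by rewrite (lt_le_trans _ hp).
have [C [M [delta [C0 M0 d0 estimate]]]] := wave_estimate p0 hm hn.
have m0 : 0 < m%:R :> R by rewrite ltr0n.
have n1 : 1 <= n%:R :> R by rewrite ler1n.
have n0 : 0 < n%:R :> R by rewrite ltr0n.
(* Chosen so that [q * (2 + 16 n^2 / delta) <= 1] below: the 2 leaves half of the frequency budget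
   [N^2] to xi, and the other term keeps t |xi|^2 within [delta] for all three waves. The leading 1
   gives [A <= A * A]. *)
pose A := 1 + m%:R * (M * M) * (2 + 16 * (n%:R * n%:R) / delta).
have B0 : 0 < 2 + 16 * (n%:R * n%:R) / delta.
  by rewrite addr_gt0// divr_gt0// !mulr_gt0.
have A1 : 1 <= A by rewrite /A lerDl mulr_ge0 ?(ltW B0)// mulr_ge0 ?mulr_ge0 ?(ltW M0).
have A0 : 0 < A by rewrite (lt_le_trans _ A1).
pose q := m%:R * (M / A * (M / A)).
have q0 : 0 <= q by rewrite /q mulr_ge0// mulr_ge0// divr_ge0 ?(ltW M0) ?(ltW A0).
have qB : q * (2 + 16 * (n%:R * n%:R) / delta) <= 1.
  have -> : q * (2 + 16 * (n%:R * n%:R) / delta) =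
      (m%:R * (M * M) * (2 + 16 * (n%:R * n%:R) / delta)) / (A * A).
    by rewrite /q; field; rewrite !gt_eqF.
  rewrite ler_pdivrMr ?mulr_gt0// mul1r (@le_trans _ _ A)//; last by rewrite ler_peMl// ltW.
  by rewrite /A lerDr.
have nd0 : 0 <= 16 * (n%:R * n%:R) / delta by rewrite divr_ge0 ?mulr_ge0// ltW.
have q2 : q <= 1 / 2.
  have qx := mulr_ge0 q0 nd0; move: qB; rewrite mulrDr; lra.
have qn : q * (16 * (n%:R * n%:R)) <= delta.
  rewrite -[leRHS]mul1r -ler_pdivrMr// -mulrA (le_trans _ qB)//.
  by rewrite ler_wpM2l// lerDr.
have qd : q <= delta.
  have h : q <= q * (n%:R * n%:R) by rewrite ler_peMr// mulr_ege1.
  lra.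
(* With [tau = d' / K.+1 ^ 2], the 1 ensures [tau <= 1], and [delta / n] bounds the phase
   [tau n K^2] by [delta]. *)
pose d' := Num.min 1 (delta / n%:R).
have d'0 : 0 < d' by rewrite lt_min ltr01 divr_gt0.
have d'1 : d' <= 1 by rewrite ge_min lexx.
have d'n : d' * n%:R <= delta by rewrite -ler_pdivlMr// ge_min lexx orbT.
pose alpha : R := m%:R / p - m%:R / 2.
pose e : R := n%:R / 2 - (n%:R + 2) / p.
(* Taking [K] as the integer part of [N / l] gives [n K^2 <= N^2 / 4], while [K.+1] stays between
   [N / l] and [l N]. *)
pose l : R := 2 * n%:R.
have l1 : 1 <= l by rewrite /l; lra.
(* The factor [2 ^ (- 1/p)] pays for [J >= T / 2]; [c'] pays for [d'] in [tau] and for replacing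
   [K.+1] by [N]. *)
pose c1 : R := C * A `^ alpha * 2 `^ (- p^-1).
pose c' : R := d' `^ p^-1 * l `^ (- `|e|).
pose c3 : R := C * A `^ alpha * c'.
have Aa0 : 0 < A `^ alpha by exact: powR_gt0.
have c10 : 0 < c1 by apply: mulr_gt0; [exact: mulr_gt0|exact: powR_gt0].
have c'0 : 0 < c'.
  by apply: mulr_gt0; apply: powR_gt0 => //; rewrite (lt_le_trans _ l1).
have c30 : 0 < c3 by apply: mulr_gt0 => //; exact: mulr_gt0.
exists (Num.min c1 (Num.min (c1 * c') c3)).
  by rewrite !lt_min c10 c30 mulr_gt0.
set c := Num.min _ _.
have cc1 : c <= c1 by rewrite ge_min lexx.
have cc2 : c <= c1 * c' by rewrite /c !ge_min lexx orbT.
have cc3 : c <= c3 by rewrite /c !ge_min lexx !orbT.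
move=> eta etaP T N T1 [j Nj].
have N1 : 1 <= N by rewrite Nj exprn_ege1// ler1n.
have N0 : 0 < N by rewrite (lt_le_trans _ N1).
have T0 : 0 < T by rewrite (lt_le_trans _ T1).
pose s := Num.sqrt T.
have s0 : 0 < s by rewrite sqrtr_gt0.
have ss : s * s = T by rewrite -expr2 sqr_sqrtr// ltW.
pose J := Num.truncn T; pose K := Num.truncn (N / l).
have /andP[JT TJ] : J%:R <= T < J.+1%:R by apply: truncn_itv; exact: ltW.
have l0 : 0 < l by rewrite (lt_le_trans _ l1).
have Nl0 : 0 <= N / l by rewrite divr_ge0// ltW.
have /andP[KN NK] : K%:R <= N / l < K.+1%:R by exact: truncn_itv.
have J1 : 1 <= J%:R :> R.
  rewrite ler1n lt0n; apply: contraTneq TJ => ->.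
  by rewrite -leNgt.
pose k : R := K.+1%:R.
have k1 : 1 <= k by rewrite ler1n.
have k0 : 0 < k by rewrite (lt_le_trans _ k1).
have kE : k = K%:R + 1 by rewrite /k natr1.
have kN : k <= l * N.
  have h : K%:R <= N.
    apply: le_trans KN _.
    by rewrite ler_pdivrMr// ler_peMr// ltW.
  have hn' : N <= n%:R * N by rewrite ler_peMl// ltW.
  rewrite kE /l; move: h hn' N1; clear; move: (K%:R) => x; lra.
pose tau := d' / (k * k).
have kk1 : 1 <= k * k by rewrite mulr_ege1.
have tau0 : 0 <= tau by rewrite divr_ge0 ?ltW// mulr_gt0.
have tau1 : tau <= 1 by rewrite ler_pdivrMr ?mul1r ?(le_trans d'1)// (lt_le_trans _ kk1).
have tau01 : 0 <= tau <= 1 by rewrite tau0.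
have tauk : tau * (k * k) = d' by rewrite /tau divfK// gt_eqF// mulr_gt0.
have K0 : 0 <= K%:R :> R by [].
have JtT : J%:R - 1 + tau <= J%:R by move: tau1; clear; lra.
have tauK : tau * (n%:R * (K%:R * K%:R)) <= delta.
  apply: le_trans d'n; rewrite -tauk mulrCA [leRHS]mulrC ler_wpM2l//.
  rewrite ler_wpM2l// ?(ltW n0)// kE ler_pM// lerDl//.
have nKK : n%:R * (K%:R * K%:R) <= N ^+ 2 / 4.
  have h1 : l * K%:R <= N by rewrite mulrC -ler_pdivlMr.
  have h2 : l * K%:R * (l * K%:R) <= N * N by rewrite ler_pM// mulr_ge0// ltW.
  have : n%:R * (K%:R * K%:R) <= n%:R * (n%:R * (K%:R * K%:R)) :> R.
    by rewrite ler_peMl// mulr_ge0// mulr_ge0.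
  rewrite expr2; move: h2; rewrite /l => h2 h3; move: h2 h3; clear.
  by move: (n%:R) (K%:R) => x y; lra.
have NN1 : 1 <= N ^+ 2 by rewrite exprn_ege1.
have MAs : m%:R * (M / (A * s) * (M / (A * s))) = q / T.
  by rewrite /q -ss; field; rewrite !gt_eqF.
have MAN : m%:R * (M / (A / N) * (M / (A / N))) = q * N ^+ 2.
  by rewrite /q; field; rewrite !gt_eqF.
have qT : q / T <= q by rewrite ler_pdivrMr// ler_peMr.
have As0 : 0 < A * s by rewrite mulr_gt0.
have AN0 : 0 < A / N by rewrite divr_gt0.
have [phi1 [u1 [nz1 sch1 est1]]]  :
    exists (phi : waveguide R m n -> R[i]) (u : R -> waveguide R m n -> R[i]),
    [/\ nonzero_L2 phi, is_schrodinger_lp eta N phi u &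
      ((C * (A * s) `^ alpha * 0.+1%:R `^ (n%:R / 2 - n%:R / p)
            * (J%:R * 1) `^ p^-1)%:E * cLnorm (lebesgue_wg m n) 2 phi
         <= cLnorm (lebesgue_itv_wg 0 T m n) p (fun tz => u tz.1 tz.2))%E].
  (* For [K = 0] the only torus frequency is 0, so unit pulses are allowed; the remaining time phase
     is at most [J q / T <= q <= delta]. *)
  apply: (estimate eta T N (A * s) 1 J 0%N) => //.
  - by rewrite ler01 lexx.
  - by rewrite subrK.
  - by rewrite MAs !mulr0 addr0; move: qT q2 NN1; clear; lra.
  - rewrite MAs subrK mulrCA (le_trans _ qd)// ler_piMr// ler_pdivrMr// mul1r//.
  - by rewrite !mulr0 ltW.
have [phi2 [u2 [nz2 sch2 est2]]]  :
    exists (phi : waveguide R m n -> R[i]) (u : R -> waveguide R m n -> R[i]),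
    [/\ nonzero_L2 phi, is_schrodinger_lp eta N phi u &
      ((C * (A * s) `^ alpha * k `^ (n%:R / 2 - n%:R / p)
            * (J%:R * tau) `^ p^-1)%:E * cLnorm (lebesgue_wg m n) 2 phi
         <= cLnorm (lebesgue_itv_wg 0 T m n) p (fun tz => u tz.1 tz.2))%E].
  (* The frequency budget is shared: [q / T <= 1 / 2] from xi and at most [N^2 / 4] from k. *)
  apply: (estimate eta T N (A * s) tau J K) => //.
  - exact: le_trans JtT JT.
  - by rewrite MAs; move: qT q2 NN1 nKK; clear; lra.
  - rewrite MAs mulrCA (le_trans _ qd)// ler_piMr// ler_pdivrMr// mul1r.
    exact: le_trans JtT JT.
have [phi3 [u3 [nz3 sch3 est3]]]  :
    exists (phi : waveguide R m n -> R[i]) (u : R -> waveguide R m n -> R[i]),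
    [/\ nonzero_L2 phi, is_schrodinger_lp eta N phi u &
      ((C * (A / N) `^ alpha * k `^ (n%:R / 2 - n%:R / p)
            * (1%:R * tau) `^ p^-1)%:E * cLnorm (lebesgue_wg m n) 2 phi
         <= cLnorm (lebesgue_itv_wg 0 T m n) p (fun tz => u tz.1 tz.2))%E].
  (* A single pulse keeps [t] below [tau], so [a] may shrink to [A / N]: the phase is at most
     [tau q N^2], and [N < l K.+1] gives [tau N^2 <= l^2 = 4 n^2]. *)
  apply: (estimate eta T N (A / N) tau 1%N K) => //.
  - by rewrite subrr add0r (le_trans tau1).
  - rewrite MAN; have h : q * N ^+ 2 <= 1 / 2 * N ^+ 2 by rewrite ler_wpM2r// sqr_ge0.
    by move: h nKK NN1; clear; lra.
  - rewrite MAN subrr add0r.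
    have h1 : N <= k * l by rewrite -ler_pdivrMr// ltW.
    have h2 : N ^+ 2 <= k * l * (k * l) by rewrite expr2 ler_pM// ltW.
    have h3 : tau * N ^+ 2 <= l * l.
      apply: (@le_trans _ _ (tau * (k * l * (k * l)))); first by rewrite ler_wpM2l.
      have -> : tau * (k * l * (k * l)) = d' * (l * l) by rewrite -tauk; ring.
      by rewrite ler_piMl// mulr_ge0// ltW.
    rewrite mulrCA (le_trans _ qn)// ler_wpM2l// (le_trans h3)// /l.
    have : 0 <= n%:R * n%:R :> R by rewrite mulr_ge0.
    by clear; move: (n%:R) => x; lra.
exists phi1, phi2, phi3, u1, u2, u3.
have ETs : (A * s) `^ alpha = A `^ alpha * T `^ (m%:R / (2 * p) - m%:R / 4).
  rewrite powRM ?(ltW A0) ?(ltW s0)// /s -powR12_sqrt ?ltW// -powRrM.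
  by congr (_ * _ `^ _); rewrite /alpha; field; rewrite gt_eqF.
(* Since [J >= 1], [T < J + 1 <= 2 J]. *)
have JTp : 2 `^ (- p^-1) * T `^ p^-1 <= J%:R `^ p^-1.
  rewrite -powRVr// -powRM ?invr_ge0 ?(ltW T0)//.
  rewrite ge0_ler_powR ?nnegrE ?mulr_ge0 ?invr_ge0 ?(ltW p0) ?(ltW T0)//.
  by move: TJ J1; rewrite -natr1; clear; move: (J%:R) => x; lra.
have mon (x y : R) (L E : \bar R) : x <= y -> (0 <= L -> y%:E * L <= E -> x%:E * L <= E)%E.
  by move=> xy L0; apply: le_trans; rewrite lee_wpmul2r// lee_fin.
(* The factor [k^-2] in [tau] lowers the exponent [n/2 - n/p] by [2/p], which gives [e]. *)
have ke : c' * N `^ e <= k `^ (n%:R / 2 - n%:R / p) * tau `^ p^-1.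
  have -> : k `^ (n%:R / 2 - n%:R / p) * tau `^ p^-1 = d' `^ p^-1 * k `^ e.
    rewrite /tau powRM ?invr_ge0 ?(ltW d'0)//; last by rewrite mulr_ge0// ltW.
    rewrite mulrCA; congr (_ * _).
    have -> : k * k = k `^ 2 by rewrite -expr2 -powR_mulrn// ltW.
    rewrite powRVr ?powR_gt0// -powRrM -powRDr//.
    by congr (_ `^ _); rewrite /e; field; rewrite gt_eqF.
  rewrite /c' -mulrA ler_wpM2l ?powR_ge0// powR_quasi// ltW//.
split=> //.
- apply: mon est1; last exact: Lnorm_ge0.
  rewrite powR1 mulr1 mulr1 ETs.
  have -> : (m%:R + 2) / (2 * p) - m%:R / 4 = m%:R / (2 * p) - m%:R / 4 + p^-1.
    by field; rewrite gt_eqF.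
  rewrite powRDr//; set X := T `^ _.
  apply: (@le_trans _ _ (c1 * (X * T `^ p^-1))).
    by rewrite ler_wpM2r// mulr_ge0 ?powR_ge0.
  have -> : c1 * (X * T `^ p^-1) = C * (A `^ alpha * X) * (2 `^ (- p^-1) * T `^ p^-1).
    by rewrite /c1; ring.
  by rewrite ler_wpM2l// !mulr_ge0 ?powR_ge0 ?(ltW C0).
- apply: mon est2; last exact: Lnorm_ge0.
  rewrite ETs -/e.
  have -> : (m%:R + 2) / (2 * p) - m%:R / 4 = m%:R / (2 * p) - m%:R / 4 + p^-1.
    by field; rewrite gt_eqF.
  rewrite powRDr//; set X := T `^ _; rewrite powRM//.
  apply: (@le_trans _ _ (c1 * c' * (X * T `^ p^-1) * N `^ e)).
    by rewrite ler_wpM2r ?powR_ge0// ler_wpM2r// mulr_ge0 ?powR_ge0.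
  have -> : c1 * c' * (X * T `^ p^-1) * N `^ e =
      C * (A `^ alpha * X) * ((c' * N `^ e) * (2 `^ (- p^-1) * T `^ p^-1)).
    by rewrite /c1; ring.
  have -> : C * (A `^ alpha * X) * k `^ (n%:R / 2 - n%:R / p) * (J%:R `^ p^-1 * tau `^ p^-1) =
      C * (A `^ alpha * X) * ((k `^ (n%:R / 2 - n%:R / p) * tau `^ p^-1) * J%:R `^ p^-1).
    by rewrite -!mulrA; congr (_ * (_ * (_ * (_ * _)))); rewrite mulrC.
  apply: ler_wpM2l; first by rewrite !mulr_ge0 ?powR_ge0 ?(ltW C0).
  by apply: ler_pM => //; rewrite mulr_ge0 ?powR_ge0 ?(ltW c'0).
- apply: mon est3; last exact: Lnorm_ge0.
  rewrite mul1r powRM ?invr_ge0 ?(ltW A0) ?(ltW N0)// powRVr//.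
  (* The width [A / N] contributes [N ^ (m/2 - m/p)], and the torus factor together with the pulse
     contributes [N ^ e]. *)
  have -> : (m + n)%:R / 2 - ((m + n)%:R + 2) / p = - alpha + e :> R.
    by rewrite natrD /alpha /e; field; rewrite gt_eqF.
  rewrite powRDr//.
  apply: (@le_trans _ _ (c3 * (N `^ (- alpha) * N `^ e))).
    by rewrite ler_wpM2r// mulr_ge0 ?powR_ge0.
  have -> : c3 * (N `^ (- alpha) * N `^ e) = C * (A `^ alpha * N `^ (- alpha)) * (c' * N `^ e).
    by rewrite /c3; ring.
  by rewrite -[leRHS]mulrA ler_wpM2l// !mulr_ge0 ?powR_ge0 ?(ltW C0).
Qed.
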